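(* For a given bounded cost function $c:\mathcal X\to\mathbb R$, there exists a constant $C=C(m,\varepsilon,\|c\|_\infty)>0$ depending only on $m,\varepsilon,\|c\|_\infty$ such that for every $N\ge 1$ $$\mathbb E\Big[S_\varepsilon(\hat\nu_1^N,\dots,\hat\nu_m^N)-S_\varepsilon(\nu_1,\dots,\nu_m)\Big]^2\le \frac{C}{N}.$$
   Context: Fix integers $m\ge 2$, $d\ge 1$ and $\varepsilon>0$; $[m]:=\{1,\dots,m\}$. For $j\in[m]$, $\mathcal X_j\subset[-1,1]^d$ is compact with non-empty interior, $\nu_j$ is a Borel probability measure on $\mathcal X_j$, and $\mathcal X=\prod_{j=1}^m\mathcal X_j$. $\Pi(\mu_1,\dots,\mu_m)$ is the set of probability measures on $\mathcal X$ with marginals $\mu_1,\dots,\mu_m$, and $\mathrm{KL}(P\|Q)=\int\log\frac{dP}{dQ}\,dP$ if $P\ll Q$, $+\infty$ otherwise. The entropic multimarginal optimal transport (EMOT) cost functional is $$S_\varepsilon(\mu_1,\dots,\mu_m)=\inf_{\pi\in\Pi(\mu_1,\dots,\mu_m)}\int_{\mathcal X}c\,d\pi+\varepsilon\,\mathrm{KL}(\pi\|\otimes_{k=1}^m\mu_k).$$ Sampling model: for each $j$, $X^{(j)}_1,\dots,X^{(j)}_N$ are i.i.d. from $\nu_j$, the $m$ samples are independent, and $\hat\nu_j^N=\frac1N\sum_{k=1}^N\delta_{X_k^{(j)}}$. *)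

(* Defs.v *)
From HB Require Import structures.
From mathcomp Require Import all_boot all_order all_algebra.
From mathcomp Require Import all_classical all_reals all_analysis.

Set Implicit Arguments.
Unset Strict Implicit.
Unset Printing Implicit Defensive.

Import Order.TTheory GRing.Theory Num.Theory.
Import numFieldNormedType.Exports.

Local Open Scope classical_set_scope.
Local Open Scope ring_scope.

(* R^d with its Borel sigma-algebra; convertible to 'rV[R]_d.               *)
Definition borel_rV (R : realType) (d : nat) :=
  g_sigma_algebraType (@open 'rV[R]_d).

Section product_probability.
Context {disp : measure_display} {T : measurableType disp} {R : realType}.

Definition tcons n (p : T * n.-tuple T) : n.+1.-tuple T :=
  [tuple of p.1 :: p.2].

Lemma measurable_tcons n : measurable_fun [set: T * n.-tuple T] (@tcons n).
Proof. exact: measurable_cons. Qed.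

HB.instance Definition _ n :=
  isMeasurableFun.Build _ _ _ _ (@tcons n) (@measurable_tcons n).

(* The sigma-algebra on n.-tuple T is the one generated by the projections.  *)
Fixpoint product_probability (n : nat) :
    ('I_n -> probability T R) -> probability (n.-tuple T) R :=
  match n with
  | 0 => fun=> dirac [tuple]
  | n'.+1 => fun mu =>
      distribution (mu ord0 \x product_probability (mu \o lift ord0))%E
                   (@tcons n')
  end.

Lemma product_probabilityE n (mu : 'I_n -> probability T R)
    (A : 'I_n -> set T) : (forall j, measurable (A j)) ->
  product_probability mu [set x | forall j, A j (tnth x j)] =
  (\prod_(j < n) mu j (A j))%E.
Proof.
elim: n mu A => [|n IHn] mu A mA /=.
  rewrite big_ord0 diracE mem_set//; last by move=> /= [].
rewrite big_ord_recl -IHn// -product_measure1E//.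
- rewrite /distribution /pushforward; congr (_ _).
  apply/seteqP; split=> -[x t] /=.
    move=> At; split=> [|j]; first exact: (At ord0).
    by have := At (lift ord0 j); rewrite /tcons tnthS.
  move=> [Ax At] j; case: (unliftP ord0 j) => [i ->|->]; last by [].
  by rewrite /tcons tnthS; exact: At.
- rewrite (_ : [set _ | _] =
    \bigcap_(j in [set: 'I_n]) ((@tnth _ T)^~ j @^-1` A (lift ord0 j))).
    apply: fin_bigcap_measurable => // j _.
    by rewrite -[X in measurable X]setTI; exact: measurable_tnth.
  by apply/seteqP; split=> x /= Ax j; [move=> _|]; exact: Ax.
Qed.

End product_probability.

Section empirical_measure.
Local Open Scope ereal_scope.
Context {disp : measure_display} {T : measurableType disp} {R : realType}.
Variables (N : nat) (x : 'I_N.+1 -> T).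

(* msum takes a family indexed by nat, whence inord.                         *)
Definition empirical : set T -> \bar R :=
  mscale ((N.+1%:R : R)^-1)%:nng%R (msum (fun k => \d_(x (inord k))) N.+1).

HB.instance Definition _ := Measure.on empirical.

Lemma empirical_setT : empirical setT = 1.
Proof.
rewrite /empirical /mscale /= /msum.
under eq_bigr => k _ do rewrite /= diracT.
by rewrite sumEFin sumr_const card_ord -EFinM mulVf// pnatr_eq0.
Qed.

HB.instance Definition _ :=
  Measure_isProbability.Build _ _ _ empirical empirical_setT.

Lemma empiricalE (A : set T) :
  empirical A = (N.+1%:R^-1)%R%:E * \sum_(k < N.+1) \d_(x k) A.
Proof.
rewrite /empirical /mscale /= /msum; congr (_ * _).
by apply: eq_bigr => k _; rewrite inord_val.
Qed.

End empirical_measure.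

Definition prod_set {S : Type} (m : nat) (X : 'I_m -> set S) :
    set (m.-tuple S) :=
  [set x | forall j, X j (tnth x j)].

Section KL.
Local Open Scope ereal_scope.
Local Open Scope charge_scope.
Context {disp : measure_display} {T : measurableType disp} {R : realType}.

Definition KL (P Q : probability T R) : \bar R :=
  if `[< P `<< Q >] then
    \int[P]_x lne (('d (charge_of_finite_measure P) '/d Q) x)
  else +oo.

End KL.

Section EMOT.
Local Open Scope ereal_scope.
Context {disp : measure_display} {T : measurableType disp} {R : realType}.

(* A probability measure on a measurable subset is encoded as a probability
   measure on the ambient space giving mass 1 to that subset.                *)
Definition couplings (m : nat) (X : 'I_m -> set T)
    (mu : 'I_m -> probability T R) : set (probability (m.-tuple T) R) :=
  [set pi | pi (prod_set X) = 1 /\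
    forall j A, measurable A -> pi ((@tnth _ T)^~ j @^-1` A) = mu j A].

Definition EMOT (m : nat) (X : 'I_m -> set T) (c : m.-tuple T -> R) (eps : R)
    (mu : 'I_m -> probability T R) : \bar R :=
  ereal_inf [set \int[pi]_(x in prod_set X) (c x)%:E
                 + eps%:E * KL pi (product_probability mu)
            | pi in couplings X mu].

End EMOT.

Definition sup_norm {S : Type} {R : realType} (D : set S) (f : S -> R) : R :=
  sup [set `|f x| | x in D].

Definition mutually_independent {disp disp' : measure_display}
    {Omega : measurableType disp} {T : measurableType disp'} {R : realType}
    (P : probability Omega R) (I : finType) (Y : I -> {RV P >-> T}) :=
  forall (J : {set I}) (A : I -> set T),
    (forall i, measurable (A i)) ->
    P (\bigcap_(i in [set` J]) (Y i @^-1` A i)) =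
    (\prod_(i in J) P (Y i @^-1` A i))%E.

(* Main.v *)
Require Import Defs.
From HB Require Import structures.
From mathcomp Require Import all_boot all_order all_algebra.
From mathcomp Require Import all_classical all_reals all_analysis.
From mathcomp Require Import measurable_realfun ring lra.
Import Order.TTheory GRing.Theory Num.Theory.
Import numFieldNormedType.Exports.
Local Open Scope classical_set_scope.
Local Open Scope ring_scope.

(** The upper and lower bounds on $S_\varepsilon(\hat\nu)-S_\varepsilon(\nu)$
    both come from the dual functional
    $$D_\mu(u)=\sum_k\int u_k\,d\mu_k+1-\int e^{\sum_k u_k-b}\,d\otimes_k\mu_k,
    \qquad b=c/\varepsilon,$$
    which satisfies $\varepsilon D_\mu(u)\le S_\varepsilon(\mu)$
    ([EMOT_ge_dual]) and is nearly attained at potentials bounded by a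
    constant depending only on $m$ and $\|b\|_\infty$
    ([near_optimal_potentials]).  Neither smoothness of the cost nor
    the dimension of the space enters, because a Sinkhorn update
    $u_j=-\log\int e^{\sum_{k\ne j}u_k-b}$ has oscillation at most
    $2\|b\|_\infty$, whatever the other potentials are.

    Let $\phi$ be near-optimal potentials for $\nu$, chosen once and for all,
    and let $a_k$ be the $k$-th marginal density, with respect to $\hat\nu_k$,
    of the Gibbs measure of $\phi$ built on $\otimes\hat\nu_k$.  Weak duality
    for $\hat\nu$ at $\phi$ bounds $S(\hat\nu)-S(\nu)$ from below.  From above,
    $S(\hat\nu)\approx\varepsilon D_{\hat\nu}(\psi)$ for some bounded $\psi$
    depending on the sample, and concavity of $D_{\hat\nu}$ yields
    $$D_{\hat\nu}(\psi)\le D_{\hat\nu}(\phi)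
      +\sum_k\int(1-a_k)(\psi_k-\phi_k)\,d\hat\nu_k ,$$
    in which $\psi$ enters only through its uniform bound.  Hence
    ([EMOT_stability]) the error is at most a constant times
    $$\sum_k\Big|\int\phi_k\,d(\hat\nu_k-\nu_k)\Big|
      +\sum_k\int|a_k-1|\,d\hat\nu_k ,$$
    up to an arbitrarily small term.  No empirical process is involved: $\phi$
    does not depend on the sample.

    Both kinds of terms are fluctuations of averages, over all combinations of
    sample points, of a fixed bounded function whose conditional mean given one
    coordinate is almost zero under $\otimes\nu_k$.  Expanding the square, all
    but a fraction $m/N$ of the pairs of combinations involve disjoint, hence
    independent, observations and contribute almost nothing
    ([mean_conditional_sqr]); this is the rate $1/N$.

    Near-optimal potentials are obtained without compactness.  An almost
    maximiser of $D_\mu$ cannot be improved much by a Sinkhorn update of any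
    single coordinate, so its marginal densities are close to $1$ in $L^1$;
    updating all coordinates at once makes this closeness uniform
    ([approximate_schrodinger]), and then an additive correction by functions
    of one coordinate turns the Gibbs density into an exact coupling, which
    competes in the primal problem ([EMOT_le_potentials]). *)

Set Implicit Arguments.
Unset Strict Implicit.
Unset Printing Implicit Defensive.

(** * Means of bounded measurable functions *)

Section bounded_measurable.
Context {d : measure_display} {T : measurableType d} {R : realType}.
Implicit Types (f g : T -> R) (P : probability T R).

Definition bmeas f :=
  measurable_fun [set: T] f /\ exists M, forall x, `|f x| <= M.

Definition mean P f : R := \int[P]_x f x.

Lemma bmeas_measurable f : bmeas f -> measurable_fun [set: T] f.
Proof. by case. Qed.

Lemma bmeas_le f M : measurable_fun [set: T] f -> (forall x, `|f x| <= M) ->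
  bmeas f.
Proof. by move=> mf fM; split => //; exists M. Qed.

Lemma bmeas_bound f : bmeas f -> exists2 M, 0 <= M & forall x, `|f x| <= M.
Proof.
move=> [_ [M fM]]; exists M => //.
exact: le_trans (normr_ge0 _) (fM point).
Qed.

Lemma eq_bmeas f g : f =1 g -> bmeas f -> bmeas g.
Proof. by move=> /funext ->. Qed.

Lemma bmeas_cst (c : R) : bmeas (fun=> c).
Proof. by apply: (@bmeas_le _ `|c|) => //; exact: measurable_cst. Qed.

Lemma bmeasD f g : bmeas f -> bmeas g -> bmeas (fun x => f x + g x).
Proof.
move=> [mf [M fM]] [mg [K gK]]; apply: (@bmeas_le _ (M + K)).
  exact: measurable_funD.
by move=> x; rewrite (le_trans (ler_normD _ _))// lerD.
Qed.

Lemma bmeasN f : bmeas f -> bmeas (fun x => - f x).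
Proof.
move=> [mf [M fM]]; apply: (@bmeas_le _ M).
  exact: measurableT_comp.
by move=> x; rewrite normrN.
Qed.

Lemma bmeasB f g : bmeas f -> bmeas g -> bmeas (fun x => f x - g x).
Proof. by move=> bf bg; apply: bmeasD => //; exact: bmeasN. Qed.

Lemma bmeasM f g : bmeas f -> bmeas g -> bmeas (fun x => f x * g x).
Proof.
move=> [mf [M fM]] [mg [K gK]]; apply: (@bmeas_le _ (M * K)).
  exact: measurable_funM.
by move=> x; rewrite normrM ler_pM.
Qed.

Lemma bmeasX f n : bmeas f -> bmeas (fun x => f x ^+ n).
Proof.
move=> bf; elim: n => [|n IHn]; first exact: bmeas_cst.
by apply: (eq_bmeas _ (bmeasM bf IHn)) => x; rewrite exprS.
Qed.

Lemma bmeas_norm f : bmeas f -> bmeas (fun x => `|f x|).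
Proof.
move=> [mf [M fM]]; apply: (@bmeas_le _ M).
  exact: measurableT_comp.
by move=> x; rewrite normr_id.
Qed.

Lemma bmeas_exp f : bmeas f -> bmeas (fun x => expR (f x)).
Proof.
move=> [mf [M fM]]; apply: (@bmeas_le _ (expR M)).
  exact: measurableT_comp.
move=> x; rewrite ger0_norm ?expR_ge0// ler_expR.
exact: le_trans (ler_norm _) (fM x).
Qed.

Lemma bmeas_ln f (c : R) : bmeas f -> 0 < c -> (forall x, c <= f x) ->
  bmeas (fun x => ln (f x)).
Proof.
move=> [mf [M fM]] c0 cf.
apply: (@bmeas_le _ (`|ln c| + `|ln M|)); first exact: measurableT_comp.
move=> x; have fx0 : 0 < f x by exact: lt_le_trans (cf x).
have fxM : f x <= M by exact: le_trans (ler_norm _) (fM x).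
have h1 : ln c <= ln (f x) by rewrite ler_ln// posrE.
have h2 : ln (f x) <= ln M by rewrite ler_ln// posrE (lt_le_trans fx0).
rewrite ler_norml; have := ler_norm (ln M); have := ler_normr (ln c) (ln c).
have := lerNnormlW (lexx `|ln c|); have := normr_ge0 (ln c).
have := normr_ge0 (ln M); lra.
Qed.

Lemma bmeas_sum (I : Type) (r : seq I) (p : pred I) (F : I -> T -> R) :
  (forall i, p i -> bmeas (F i)) -> bmeas (fun x => \sum_(i <- r | p i) F i x).
Proof.
move=> bF; elim: r => [|i r IHr].
  by apply: (eq_bmeas _ (bmeas_cst 0)) => x; rewrite big_nil.
have [pi|npi] := boolP (p i).
  apply: (eq_bmeas _ (bmeasD (bF i pi) IHr)) => x.
  by rewrite big_cons pi.
by apply: (eq_bmeas _ IHr) => x; rewrite big_cons (negbTE npi).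
Qed.

Lemma bmeas_indic (A : set T) : measurable A -> bmeas (\1_A : T -> R).
Proof.
move=> mA; apply: (@bmeas_le _ 1) => [|x]; first exact: measurable_indic.
by rewrite indicE; case: (_ \in _); rewrite ?normr1// normr0.
Qed.

Lemma bmeas_integrable P f : bmeas f -> P.-integrable [set: T] (EFin \o f).
Proof.
move=> [mf [M fM]]; apply: measurable_bounded_integrable => //.
  by rewrite -ge0_fin_numE// fin_num_measure.
exists M; split; first exact: num_real.
by move=> y My x _ /=; exact: le_trans (fM x) (ltW My).
Qed.

Lemma meanE P f : bmeas f -> (\int[P]_x (f x)%:E)%E = (mean P f)%:E.
Proof.
move=> /(bmeas_integrable P) fi; rewrite /mean /Rintegral fineK//.
exact: integrable_fin_num.
Qed.

Lemma mean_cst P (c : R) : mean P (fun=> c) = c.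
Proof.
rewrite /mean Rintegral_cst// [X in fine X](_ : _ = 1%E) ?mulr1//.
exact: probability_setT.
Qed.

Lemma eq_mean P f g : f =1 g -> mean P f = mean P g.
Proof. by move=> fg; rewrite /mean; apply: eq_Rintegral => x _. Qed.

Lemma meanD P f g : bmeas f -> bmeas g ->
  mean P (fun x => f x + g x) = mean P f + mean P g.
Proof. by move=> bf bg; rewrite /mean RintegralD//; exact: bmeas_integrable. Qed.

Lemma meanB P f g : bmeas f -> bmeas g ->
  mean P (fun x => f x - g x) = mean P f - mean P g.
Proof. by move=> bf bg; rewrite /mean RintegralB//; exact: bmeas_integrable. Qed.

Lemma meanZl P f (c : R) : bmeas f -> mean P (fun x => c * f x) = c * mean P f.
Proof. by move=> bf; rewrite /mean RintegralZl//; exact: bmeas_integrable. Qed.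

Lemma mean_sum P (I : Type) (r : seq I) (p : pred I) (F : I -> T -> R) :
  (forall i, p i -> bmeas (F i)) ->
  mean P (fun x => \sum_(i <- r | p i) F i x) =
  \sum_(i <- r | p i) mean P (F i).
Proof.
move=> bF; elim: r => [|i r IHr].
  by rewrite big_nil -[RHS](mean_cst P); apply: eq_mean => x; rewrite big_nil.
rewrite big_cons.
have [pi|npi] := boolP (p i).
  rewrite -IHr -meanD; [|exact: bF|exact: bmeas_sum].
  by apply: eq_mean => x; rewrite big_cons pi.
by rewrite -IHr; apply: eq_mean => x; rewrite big_cons (negbTE npi).
Qed.

Lemma le_mean P f g : bmeas f -> bmeas g -> (forall x, f x <= g x) ->
  mean P f <= mean P g.
Proof.
by move=> bf bg fg; apply: le_Rintegral => //; exact: bmeas_integrable.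
Qed.

Lemma mean_ge0 P f : (forall x, 0 <= f x) -> 0 <= mean P f.
Proof. by move=> f0; exact: Rintegral_ge0. Qed.

Lemma mean_le_cst P f (c : R) : bmeas f -> (forall x, f x <= c) ->
  mean P f <= c.
Proof.
by move=> bf fc; rewrite -(mean_cst P c); apply: le_mean => //; exact: bmeas_cst.
Qed.

Lemma mean_ge_cst P f (c : R) : bmeas f -> (forall x, c <= f x) ->
  c <= mean P f.
Proof.
by move=> bf fc; rewrite -(mean_cst P c); apply: le_mean => //; exact: bmeas_cst.
Qed.

Lemma le_norm_mean P f : bmeas f -> `|mean P f| <= mean P (fun x => `|f x|).
Proof. by move=> bf; apply: le_normr_Rintegral => //; exact: bmeas_integrable. Qed.

Lemma norm_mean_le P f (c : R) : bmeas f -> (forall x, `|f x| <= c) ->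
  `|mean P f| <= c.
Proof.
move=> bf fc; apply: le_trans (le_norm_mean _ bf) _.
by apply: mean_le_cst => //; exact: bmeas_norm.
Qed.

Lemma mean_indic P (A : set T) : measurable A -> mean P \1_A = fine (P A).
Proof. by move=> mA; rewrite /mean /Rintegral integral_indic// setIT. Qed.

Lemma mean_indicE P (A : set T) : measurable A -> P A = (mean P \1_A)%:E.
Proof.
by move=> mA; rewrite mean_indic// fineK// fin_num_measure.
Qed.

Lemma sqr_mean_le P f : bmeas f -> mean P f ^+ 2 <= mean P (fun x => f x ^+ 2).
Proof.
move=> bf; set a := mean P f.
have bf2 : bmeas (fun x => f x ^+ 2).
  exact: bmeasX.
have baf : bmeas (fun x => (2 * a) * f x).
  by apply: bmeasM => //; exact: bmeas_cst.
have : 0 <= mean P (fun x => f x ^+ 2 - (2 * a) * f x + a ^+ 2).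
  apply: mean_ge0 => x.
  by rewrite (_ : _ + _ = (f x - a) ^+ 2) ?sqr_ge0//; ring.
rewrite (meanD _ (bmeasB bf2 baf) (bmeas_cst _)) (meanB _ bf2 baf).
rewrite (meanZl _ _ bf) mean_cst -/a -mulrA -expr2; lra.
Qed.

Lemma eq_prob_mean P (Q : probability T R) f :
  (forall A, measurable A -> P A = Q A) -> mean P f = mean Q f.
Proof.
move=> PQ; rewrite /mean /Rintegral (eq_measure_integral Q)//.
by move=> A mA _; exact: PQ.
Qed.

End bounded_measurable.

Section mean_maps.
Context {d d' : measure_display} {T : measurableType d} {U : measurableType d'}.
Context {R : realType}.

Lemma bmeas_comp (g : T -> U) (f : U -> R) : measurable_fun [set: T] g ->
  bmeas f -> bmeas (fun x => f (g x)).
Proof.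
move=> mg [mf [M fM]]; apply: (@bmeas_le _ _ _ _ M) => //.
exact: (measurableT_comp mf).
Qed.

Lemma mean_distribution (P : probability T R) (X : {RV P >-> U}) (f : U -> R) :
  bmeas f -> mean (distribution P X) f = mean P (fun x => f (X x)).
Proof.
move=> bf; rewrite /mean /Rintegral; congr fine.
rewrite /distribution integral_pushforward//=.
- exact/measurable_EFinP/bmeas_measurable.
- rewrite preimage_setT.
  by apply: (@bmeas_integrable _ _ _ P (fun x => f (X x))); exact: bmeas_comp.
Qed.

End mean_maps.

Section fubini.
Context {d d' : measure_display} {T : measurableType d} {U : measurableType d'}.
Context {R : realType}.
Variables (P : probability T R) (Q : probability U R) (f : T * U -> R).
Hypothesis bf : bmeas f.

Let bf_pair x : bmeas (fun y => f (x, y)).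
Proof. exact: (bmeas_comp (pair1_measurable x) bf). Qed.

Lemma bmeas_fubini : bmeas (fun x => mean Q (fun y => f (x, y))).
Proof.
case: (bf) => mf [M fM]; apply: (@bmeas_le _ _ _ _ M); last first.
  by move=> x; apply: norm_mean_le.
have := @measurable_fubini_F _ _ _ _ _ P Q (EFin \o f)
  (bmeas_integrable (P \x Q)%E bf).
by move=> mF; exact: measurableT_comp mF.
Qed.

Lemma mean_fubini :
  mean (P \x Q)%E f = mean P (fun x => mean Q (fun y => f (x, y))).
Proof.
rewrite {1}/mean /Rintegral.
rewrite -(@integral12_prod_meas1 _ _ _ _ _ P Q (EFin \o f)); last first.
  exact: (bmeas_integrable (P \x Q)%E bf).
congr fine; apply: eq_integral => x _; rewrite /fubini_F meanE//.
Qed.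

End fubini.

#[global] Opaque mean.

(** * Product measures on tuples *)

Section boxes.
Context {d : measure_display} {T : measurableType d} {R : realType}.

Lemma prod_set_bigcap m (A : 'I_m -> set T) :
  prod_set A = \bigcap_(j in [set: 'I_m]) ((@tnth _ T)^~ j @^-1` A j).
Proof. by apply/seteqP; split=> x /= Ax j; [move=> _|]; exact: Ax. Qed.

Lemma measurable_prod_set m (A : 'I_m -> set T) :
  (forall j, measurable (A j)) -> measurable (prod_set A).
Proof.
move=> mA; rewrite prod_set_bigcap; apply: fin_bigcap_measurable => // j _.
by rewrite -[X in measurable X]setTI; exact: measurable_tnth.
Qed.

Lemma measurable_tuple_box m : (@measurable _ (m.-tuple T)) =
  <<s [set prod_set A | A in
        [set A : 'I_m -> set T | forall j, measurable (A j)]] >>.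
Proof.
apply/seteqP; split.
  apply: smallest_sub; first exact: smallest_sigma_algebra.
  rewrite -bigcup_seq => _ [j _ [A mA <-]].
  apply: sub_sigma_algebra; exists (fun k => if k == j then A else setT).
    by move=> k /=; case: ifP.
  rewrite setTI; apply/seteqP; split=> x /=; first by move/(_ j); rewrite eqxx.
  by move=> Ax k; case: eqP => // ->.
apply: smallest_sub; first exact: sigma_algebra_measurable.
by move=> _ [A mA <-]; exact: measurable_prod_set.
Qed.

(** Boxes are stable under intersection and generate the $\sigma$-algebra;
    every identification of a product law below goes through this lemma. *)
Lemma eq_probability_box m (P Q : probability (m.-tuple T) R) :
  (forall A : 'I_m -> set T, (forall j, measurable (A j)) ->
    P (prod_set A) = Q (prod_set A)) ->
  forall B, measurable B -> P B = Q B.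
Proof.
move=> PQ B mB.
apply: (measure_unique _ (fun=> setT) (measurable_tuple_box m)) => //.
- move=> _ _ [A mA <-] [A' mA' <-]; exists (fun j => A j `&` A' j).
    by move=> j /=; exact: measurableI.
  apply/seteqP; split=> x /=; first by move=> AA'; split=> j; have [] := AA' j.
  by move=> [Ax A'x] j; split; [exact: Ax|exact: A'x].
- by move=> _; exists (fun=> setT) => //; apply/seteqP; split.
- by apply/seteqP; split => // x _; exists 0%N.
- by move=> _ [A mA <-]; exact: PQ.
- by move=> _; rewrite -ge0_fin_numE// fin_num_measure.
Qed.

End boxes.

(** Existential form of the image measure, so that it can be used for a map
    which carries no measurable-function structure. *)
Lemma image_probability {d d' : measure_display} {T : measurableType d}
    {U : measurableType d'} {R : realType} (P : probability T R) (g : T -> U) :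
  measurable_fun [set: T] g ->
  exists Pg : probability U R, (forall A, Pg A = P (g @^-1` A)) /\
    forall f, bmeas f -> mean Pg f = mean P (fun x => f (g x)).
Proof.
move=> mg; pose X : {RV P >-> U} := HB.pack g (isMeasurableFun.Build _ _ _ _ g mg).
exists (distribution P X); split => // f bf.
exact: mean_distribution.
Qed.

Section resampling.
Context {d : measure_display} {T : measurableType d} {R : realType} {m : nat}.
Implicit Types (mu : 'I_m -> probability T R) (x : m.-tuple T).

Definition upd (j : 'I_m) (y : T) x : m.-tuple T :=
  [tuple if k == j then y else tnth x k | k < m].

Lemma tnth_upd j y x k : tnth (upd j y x) k = if k == j then y else tnth x k.
Proof. by rewrite tnth_mktuple. Qed.

Lemma measurable_upd j :
  measurable_fun [set: T * m.-tuple T] (fun p => upd j p.1 p.2).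
Proof.
apply/measurable_fun_tnthP => k.
have mk : measurable_fun [set: T * m.-tuple T]
    (fun p => if k == j then p.1 else tnth p.2 k).
  case: (k == j); first exact: measurable_fst.
  exact: (measurableT_comp (measurable_tnth k) measurable_snd).
by apply: (eq_measurable_fun _ _ mk) => p _ /=; rewrite tnth_upd.
Qed.

Lemma bmeas_updE j (f : m.-tuple T -> R) :
  bmeas f -> bmeas (fun p : T * m.-tuple T => f (upd j p.1 p.2)).
Proof. exact: (bmeas_comp (measurable_upd j)). Qed.

Lemma bmeas_upd j (f : m.-tuple T -> R) y :
  bmeas f -> bmeas (fun x => f (upd j y x)).
Proof.
move=> bf; exact: (bmeas_comp (pair1_measurable y) (bmeas_updE j bf)).
Qed.

Lemma bmeas_tnth j (f : T -> R) :
  bmeas f -> bmeas (fun x : m.-tuple T => f (tnth x j)).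
Proof. exact: (bmeas_comp (measurable_tnth j)). Qed.

(** Replacing the $j$-th coordinate of a sample of a product law by an
    independent copy does not change the law.  This plays the part of
    Fubini's theorem for one distinguished coordinate. *)
Lemma mean_resample mu j (f : m.-tuple T -> R) : bmeas f ->
  mean (product_probability mu) f =
  mean (mu j) (fun y => mean (product_probability mu) (fun x => f (upd j y x))).
Proof.
move=> bf; set Q := product_probability mu.
have [Pg [PgE meanPg]] := image_probability (mu j \x Q)%E (measurable_upd j).
rewrite -(mean_fubini _ _ (bmeas_updE j bf)) -meanPg//.
apply: eq_prob_mean; apply: eq_probability_box => A mA.
rewrite PgE [LHS]product_probabilityE//.
rewrite (_ : _ @^-1` _ =
    A j `*` prod_set (fun k => if k == j then setT else A k)); last first.
  apply/seteqP; split => -[y x] /=.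
    move=> Ax; split; first by have := Ax j; rewrite tnth_upd eqxx.
    by move=> k; have := Ax k; rewrite tnth_upd; case: ifP.
  by move=> [Ay Ax] k; have := Ax k; rewrite tnth_upd; case: eqP => // ->.
have mA' k : measurable (if k == j then setT else A k) by case: ifP.
set A' := prod_set _.
transitivity (mu j (A j) * Q A')%E; last first.
  apply/esym/product_measure1E => //.
  exact: measurable_prod_set.
rewrite [Q A']product_probabilityE//.
rewrite (bigD1 j)//= [in RHS](bigD1 j)//= eqxx; congr (_ * _)%E.
rewrite [X in (X * _)%E](_ : _ = 1%E) ?mul1e; last exact: probability_setT.
by apply: eq_bigr => k /negbTE ->.
Qed.

Lemma mean_tnth mu j (f : T -> R) : bmeas f ->
  mean (product_probability mu) (fun x => f (tnth x j)) = mean (mu j) f.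
Proof.
move=> bf; rewrite (mean_resample _ j)//; last exact: bmeas_tnth.
apply: eq_mean => y; rewrite -[RHS](mean_cst (product_probability mu)).
by apply: eq_mean => x; rewrite tnth_upd eqxx.
Qed.

Lemma bmeas_mean_upd mu j (f : m.-tuple T -> R) : bmeas f ->
  bmeas (fun y => mean (product_probability mu) (fun x => f (upd j y x))).
Proof.
move=> bf; exact: (bmeas_fubini (mu j) (product_probability mu) (bmeas_updE j bf)).
Qed.

Lemma mean_mul_tnth mu j (h : T -> R) (f : m.-tuple T -> R) :
  bmeas h -> bmeas f ->
  mean (product_probability mu) (fun x => h (tnth x j) * f x) =
  mean (mu j) (fun y =>
    h y * mean (product_probability mu) (fun x => f (upd j y x))).
Proof.
move=> bh bf; rewrite (mean_resample _ j); last first.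
  by apply: bmeasM => //; exact: bmeas_tnth.
apply: eq_mean => y; rewrite -meanZl; last exact: bmeas_upd.
by apply: eq_mean => x; rewrite tnth_upd eqxx.
Qed.

End resampling.

(** * The dual functional and Sinkhorn updates *)

Section dual.
Context {d : measure_display} {T : measurableType d} {R : realType} {m : nat}.
Implicit Types (mu : 'I_m -> probability T R) (b : m.-tuple T -> R)
  (u : 'I_m -> T -> R) (j : 'I_m) (x : m.-tuple T) (y : T).

Definition setp u j (v : T -> R) : 'I_m -> T -> R :=
  fun k => if k == j then v else u k.

(** Unnormalised density, with respect to the product of the marginals, of the
    measure attached to the potentials [u]. *)
Definition gibbs b u x := expR (\sum_k u k (tnth x k) - b x).

(** Density of the [j]-th marginal of the Gibbs measure with respect to
    [mu j].  The $j$-th coordinate of a full sample is overwritten by [y], which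
    avoids a separate product over the other coordinates. *)
Definition marg mu b u j y :=
  mean (product_probability mu) (fun x => gibbs b u (upd j y x)).

Definition dual mu b u :=
  \sum_k mean (mu k) (u k) + 1 - mean (product_probability mu) (gibbs b u).

Lemma margE mu b u j y : marg mu b u j y =
  mean (product_probability mu) (fun x => gibbs b u (upd j y x)).
Proof. by []. Qed.

Lemma dualE mu b u : dual mu b u =
  \sum_k mean (mu k) (u k) + 1 - mean (product_probability mu) (gibbs b u).
Proof. by []. Qed.

(** The Sinkhorn update of the [j]-th potential: it depends on the other
    potentials only, as the [j]-th one is reset to $0$. *)
Definition softmin mu b u j y := - ln (marg mu b (setp u j (fun=> 0)) j y).

Definition potentials u := forall k, bmeas (u k).

Variables (mu : 'I_m -> probability T R) (b : m.-tuple T -> R) (B : R).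
Hypotheses (mb : bmeas b) (bB : forall x, `|b x| <= B).

Local Notation Q := (product_probability mu).

Lemma potentials_setp u j v : potentials u -> bmeas v -> potentials (setp u j v).
Proof. by move=> pu bv k; rewrite /setp; case: ifP. Qed.

Lemma bmeas_sum_tnth u : potentials u ->
  bmeas (fun x : m.-tuple T => \sum_k u k (tnth x k)).
Proof. by move=> pu; apply: bmeas_sum => k _; exact: bmeas_tnth. Qed.

Lemma bmeas_log_gibbs u : potentials u ->
  bmeas (fun x : m.-tuple T => \sum_k u k (tnth x k) - b x).
Proof. by move=> pu; apply: bmeasB => //; exact: bmeas_sum_tnth. Qed.

Lemma bmeas_gibbs u : potentials u -> bmeas (gibbs b u).
Proof. by move=> pu; apply: bmeas_exp; exact: bmeas_log_gibbs. Qed.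

Lemma bmeas_marg u j : potentials u -> bmeas (marg mu b u j).
Proof. by move=> pu; apply: bmeas_mean_upd; exact: bmeas_gibbs. Qed.

Lemma mean_marg u j : potentials u ->
  mean (mu j) (marg mu b u j) = mean Q (gibbs b u).
Proof. by move=> pu; rewrite -mean_resample//; exact: bmeas_gibbs. Qed.

Lemma marg_bounds u j (L : R) : potentials u ->
  (forall x, `|\sum_k u k (tnth x k) - b x| <= L) ->
  forall y, expR (- L) <= marg mu b u j y <= expR L.
Proof.
move=> pu uL y; have bg := bmeas_upd j y (bmeas_gibbs pu).
apply/andP; split; [apply: mean_ge_cst => //|apply: mean_le_cst => //] => x;
  by rewrite ler_expR; have := uL (upd j y x); rewrite ler_norml => /andP[].
Qed.

Lemma sum_upd u j y x : \sum_k u k (tnth (upd j y x) k) =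
  u j y + \sum_(k | k != j) u k (tnth x k).
Proof.
rewrite (bigD1 j)//= tnth_upd eqxx; congr (_ + _).
by apply: eq_bigr => k /negbTE kj; rewrite tnth_upd kj.
Qed.

Lemma sum_setp u j v y x : \sum_k setp u j v k (tnth (upd j y x) k) =
  v y + \sum_(k | k != j) u k (tnth x k).
Proof.
rewrite sum_upd /setp eqxx; congr (_ + _).
by apply: eq_bigr => k /negbTE ->.
Qed.

Lemma marg_setp u j v y : potentials u ->
  marg mu b (setp u j v) j y = expR (v y) * marg mu b (setp u j (fun=> 0)) j y.
Proof.
move=> pu; rewrite /marg -meanZl; last first.
  by apply: bmeas_upd; apply: bmeas_gibbs; apply: potentials_setp => //;
    exact: bmeas_cst.
by apply: eq_mean => x; rewrite /gibbs !sum_setp -expRD add0r addrA.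
Qed.

Lemma setp_id u j : setp u j (u j) = u.
Proof. by apply/funext => k; rewrite /setp; case: eqP => // ->. Qed.

Lemma marg_gt0 u j y : potentials u -> 0 < marg mu b u j y.
Proof.
move=> pu; have [L _ uL] := bmeas_bound (bmeas_log_gibbs pu).
by have /andP[+ _] := marg_bounds j pu uL y; apply: lt_le_trans; exact: expR_gt0.
Qed.

Lemma potentials0 u j : potentials u -> potentials (setp u j (fun=> 0)).
Proof. by move=> pu; apply: potentials_setp => //; exact: bmeas_cst. Qed.

Lemma bmeas_softmin u j : potentials u -> bmeas (softmin mu b u j).
Proof.
move=> /(@potentials0 _ j) pu; apply: bmeasN.
have [L _ uL] := bmeas_bound (bmeas_log_gibbs pu).
apply: (@bmeas_ln _ _ _ _ (expR (- L))); [exact: bmeas_marg|exact: expR_gt0|].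
by move=> y; have /andP[] := marg_bounds j pu uL y.
Qed.

Lemma marg_softmin u j y : potentials u ->
  marg mu b u j y = expR (u j y - softmin mu b u j y).
Proof.
move=> pu; rewrite -{1}(setp_id u j) marg_setp// opprK expRD lnK// posrE.
by apply: marg_gt0; exact: potentials0.
Qed.

(** The update sees its argument only through the cost, so its oscillation is
    controlled by the cost alone. *)
Lemma softmin_osc u j y y' : potentials u ->
  softmin mu b u j y - softmin mu b u j y' <= 2 * B.
Proof.
move=> /(@potentials0 _ j) pu; rewrite /softmin.
set G := marg mu b _ j.
have Gy z : 0 < G z by exact: marg_gt0.
suff : ln (G y') <= 2 * B + ln (G y) by lra.
rewrite -(expRK (2 * B)) -lnM ?posrE ?expR_gt0// ler_ln ?posrE ?mulr_gt0 ?expR_gt0//.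
rewrite /G /marg -meanZl; last by apply: bmeas_upd; exact: bmeas_gibbs.
apply: le_mean.
- by apply: bmeas_upd; exact: bmeas_gibbs.
- apply: bmeasM; first exact: bmeas_cst.
  by apply: bmeas_upd; exact: bmeas_gibbs.
- move=> x; rewrite /gibbs -expRD ler_expR !sum_setp.
  have := bB (upd j y x); have := bB (upd j y' x); rewrite !ler_norml.
  move=> /andP[? ?] /andP[? ?]; lra.
Qed.

Lemma norm_sum_tnth u (K : R) x : (forall k y, `|u k y| <= K) ->
  `|\sum_k u k (tnth x k)| <= m%:R * K.
Proof.
move=> uK; apply: le_trans (ler_norm_sum _ _ _) _.
rewrite mulr_natl -[X in _ *+ X]card_ord -sumr_const.
by apply: ler_sum => k _.
Qed.

Lemma log_gibbs_le u (K : R) x : (forall k y, `|u k y| <= K) ->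
  `|\sum_k u k (tnth x k) - b x| <= m%:R * K + B.
Proof.
move=> uK; apply: le_trans (ler_normB _ _) _.
by apply: lerD; [exact: norm_sum_tnth|exact: bB].
Qed.

Lemma softmin_le u j (K : R) y : 0 <= K -> potentials u ->
  (forall k y, k != j -> `|u k y| <= K) ->
  `|softmin mu b u j y| <= m%:R * K + B.
Proof.
move=> K0 pu uK; rewrite /softmin normrN.
have pu0 := @potentials0 u j pu.
have uK0 k z : `|setp u j (fun=> 0) k z| <= K.
  rewrite /setp; case: eqP => [_|/eqP kj]; last exact: uK.
  by rewrite normr0.
have /andP[h1 h2] := marg_bounds j pu0 (fun x => log_gibbs_le x uK0) y.
rewrite -[m%:R * K + B]expRK ler_norml -lnV ?posrE ?expR_gt0// -expRN.
by rewrite !ler_ln ?posrE ?expR_gt0 ?marg_gt0// h1.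
Qed.

Lemma softmin_setp u j v : softmin mu b (setp u j v) j = softmin mu b u j.
Proof.
apply/funext => y; rewrite /softmin; congr (- ln (marg mu b _ j y)).
by apply/funext => k; rewrite /setp; case: eqP.
Qed.

Lemma marg_sinkhorn u j y : potentials u ->
  marg mu b (setp u j (softmin mu b u j)) j y = 1.
Proof.
move=> pu; have pu' := potentials_setp j pu (bmeas_softmin j pu).
by rewrite marg_softmin// softmin_setp /setp eqxx subrr expR0.
Qed.

(** With $a$ the former marginal density, the linear part changes by
    $-\int\log a\,d\mu_j$ and the mass of the Gibbs measure goes from
    $\int a\,d\mu_j$ to $1$, since the new density is $1$.  The gain is
    nonnegative and controls the distance of $a$ to $1$. *)
Lemma dual_sinkhorn u j : potentials u ->
  dual mu b (setp u j (softmin mu b u j)) = dual mu b u +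
  mean (mu j) (fun y => marg mu b u j y - 1 - (u j y - softmin mu b u j y)).
Proof.
move=> pu; have bs := bmeas_softmin j pu.
have pu' := potentials_setp j pu bs.
rewrite meanB; [|apply: bmeasB|apply: bmeasB] => //; first last.
- exact: bmeas_cst.
- exact: bmeas_marg.
rewrite (meanB _ (bmeas_marg j pu) (bmeas_cst 1)) (meanB _ (pu j) bs) mean_cst.
rewrite mean_marg// /dual -(mean_marg j pu').
rewrite (_ : mean (mu j) (marg _ _ (setp _ _ _) _) = 1); last first.
  rewrite -[RHS](mean_cst (mu j)); apply: eq_mean => y.
  exact: marg_sinkhorn.
rewrite (bigD1 j)//= [in RHS](bigD1 j)//= {1}/setp eqxx.
rewrite (eq_bigr (fun k => mean (mu k) (u k))); last first.
  by move=> k /negbTE kj; rewrite /setp kj.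
lra.
Qed.

End dual.

#[global] Opaque marg dual softmin.

(** * Almost solutions of the Schroedinger system *)

Section approximate_maximizer.
Context {d : measure_display} {T : measurableType d} {R : realType} {m : nat}.
Variables (mu : 'I_m -> probability T R) (b : m.-tuple T -> R) (B : R).
Hypotheses (mb : bmeas b) (bB : forall x, `|b x| <= B).
Implicit Types (u : 'I_m -> T -> R) (j : 'I_m).

Local Notation Q := (product_probability mu).
Local Notation marg := (marg mu b).
Local Notation dual := (dual mu b).
Local Notation softmin := (softmin mu b).

Let B0 : 0 <= B.
Proof. by apply: le_trans (bB point); exact: normr_ge0. Qed.

(** By $e^t\ge1+t$; this is weak duality against the product coupling. *)
Lemma dual_le u : potentials u -> dual u <= B.
Proof.
move=> pu; have bg := bmeas_gibbs mb pu; have bs := bmeas_sum_tnth pu.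
have : mean Q (fun x => 1 + (\sum_k u k (tnth x k) - b x)) <= mean Q (gibbs b u).
  apply: le_mean => //; last by move=> x; exact: expR_ge1Dx.
  by apply: bmeasD; [exact: bmeas_cst|exact: bmeas_log_gibbs].
rewrite (meanD _ (bmeas_cst 1) (bmeas_log_gibbs mb pu)) (meanB _ bs mb) mean_cst.
rewrite mean_sum; last by move=> k _; exact: bmeas_tnth.
rewrite (eq_bigr (fun k => mean (mu k) (u k))); last by move=> k _; rewrite mean_tnth.
have : mean Q b <= B.
  by apply: mean_le_cst => // x; exact: le_trans (ler_norm _) (bB x).
rewrite dualE; lra.
Qed.

Lemma dual_sinkhorn_ge u j : potentials u ->
  dual u <= dual (setp u j (softmin u j)).
Proof.
move=> pu; rewrite (dual_sinkhorn mu mb)// lerDl; apply: mean_ge0 => y.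
rewrite (marg_softmin mu mb)//; set t := u j y - _.
by have := expR_ge1Dx t; lra.
Qed.

(** Only the sum of the potentials enters the Gibbs density, so an additive
    constant can be moved from the index [j] to the index [j0]. *)
Lemma sum_shift (a : 'I_m -> R) j (j0 : 'I_m) (t : R) : j != j0 ->
  \sum_k (if k == j0 then a j0 + t else if k == j then a j - t else a k) =
  \sum_k a k.
Proof.
move=> jj0; rewrite (bigD1 j0)//= eqxx (bigD1 j)//= (negbTE jj0) eqxx.
rewrite [RHS](bigD1 j0)//= [in RHS](bigD1 j)//=.
rewrite (eq_bigr a); first by ring.
by move=> k /andP[/negbTE -> /negbTE ->].
Qed.

Lemma dual_shift u j j0 (t : R) : j != j0 -> potentials u ->
  dual (setp (setp u j (fun y => u j y - t)) j0 (fun y => u j0 y + t)) = dual u.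
Proof.
move=> jj0 pu; rewrite !dualE; congr (_ + _ - _).
  rewrite -(sum_shift (fun k => mean (mu k) (u k)) t jj0).
  apply: eq_bigr => k _; rewrite /setp.
  have [->|_] := eqVneq k j0; first by rewrite (meanD _ _ (bmeas_cst t)) ?mean_cst.
  have [->|//] := eqVneq k j; first by rewrite (meanB _ _ (bmeas_cst t)) ?mean_cst.
apply: eq_mean => x; rewrite /gibbs.
rewrite -(sum_shift (fun k => u k (tnth x k)) t jj0).
rewrite (eq_bigr (fun k => if k == j0 then u j0 (tnth x j0) + t else
  if k == j then u j (tnth x j) - t else u k (tnth x k)))// => k _.
by rewrite /setp; case: eqP => [->//|_]; case: eqP => [->|].
Qed.

(** An updated potential has bounded oscillation, but its size is not
    controlled; moving its additive constant to an index [j0] that is never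
    updated makes it bounded. *)
Lemma sinkhorn_sweep u j0 (s : seq 'I_m) : potentials u -> j0 \notin s ->
  exists u', [/\ potentials u', dual u <= dual u' &
    forall k y, k \in s -> `|u' k y| <= 2 * B].
Proof.
move=> pu; elim: s => [_|j s IHs]; first by exists u; split.
rewrite inE negb_or eq_sym => /andP[jj0 j0s].
have [v [pv uv vs]] := IHs j0s.
pose w := setp v j (softmin v j).
have bs := bmeas_softmin mu mb j pv.
have pw : potentials w by exact: potentials_setp.
set t := softmin v j point.
exists (setp (setp w j (fun y => w j y - t)) j0 (fun y => w j0 y + t)); split.
- have bj := bmeasB (pw j) (bmeas_cst t).
  exact: (potentials_setp j0 (potentials_setp j pw bj)
    (bmeasD (pw j0) (bmeas_cst t))).
- rewrite (dual_shift t jj0 pw); apply: le_trans uv _.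
  exact: dual_sinkhorn_ge.
- move=> k y ks; rewrite /setp; case: eqP => [kj0|_].
    by move: ks; rewrite kj0 inE eq_sym (negbTE jj0) (negbTE j0s).
  case: eqP => [_|/eqP kj]; last first.
    rewrite /w /setp (negbTE kj); apply: vs.
    by move: ks; rewrite inE (negbTE kj).
  rewrite /w /setp eqxx ler_norml.
  have h1 := softmin_osc mu mb bB j y point pv.
  have h2 := softmin_osc mu mb bB j point y pv.
  by rewrite h1 andbT lerNl opprB.
Qed.

(** The sweep bounds every potential except the one storing the constants;
    a last Sinkhorn step at that index bounds it in terms of the others. *)
Lemma approximate_maximizer (j0 : 'I_m) (eta : R) : 0 < eta ->
  exists v, [/\ potentials v,
    forall k y, `|v k y| <= m%:R * (2 * B) + B &
    forall u, potentials u -> dual u <= dual v + eta].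
Proof.
move=> eta0.
have supD : has_sup [set dual u | u in potentials].
  split.
    by exists (dual (fun _ _ => 0)), (fun _ _ => 0) => // k; exact: bmeas_cst.
  by exists B => _ [u pu <-]; exact: dual_le.
have [_ [u pu <-] uD] := sup_adherent eta0 supD.
have := @sinkhorn_sweep u j0 [seq k <- enum 'I_m | k != j0] pu.
rewrite mem_filter eqxx => /(_ isT)[v [pv uv vB]].
have vB' k y : k != j0 -> `|v k y| <= 2 * B.
  by move=> kj0; apply: vB; rewrite mem_filter kj0 mem_enum.
exists (setp v j0 (softmin v j0)); split.
- by apply: potentials_setp => //; exact: bmeas_softmin.
- move=> k y; rewrite /setp; case: eqP => [_|/eqP kj0].
    by apply: softmin_le => //; rewrite mulr_ge0.
  apply: (le_trans (vB' _ _ kj0)); rewrite -[leLHS]addr0 lerD// ler_peMl//.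
    by rewrite mulr_ge0.
  by rewrite ler1n (leq_trans _ (ltn_ord k)).
- move=> w pw; have wD : dual w <= sup [set dual u | u in potentials].
    by apply: sup_upper_bound => //; exists w.
  apply: (le_trans wD); rewrite -lerBlDr; apply: (le_trans (ltW uD)).
  exact: le_trans uv (dual_sinkhorn_ge j0 pv).
Qed.

(** The exponential lies above its tangents at $\log(1\pm s)$, and
    $\log(1\pm s)\le\pm s$.  This turns a small dual gain into $L^1$
    smallness of the logarithms of the marginal densities. *)
Lemma expR_gap (s t : R) : 0 < s -> s < 1 ->
  s * `|t| - s ^+ 2 <= expR t - 1 - t.
Proof.
move=> s0 s1.
have tangent (a : R) : -1 < a -> (1 + a) * (1 + t - a) <= expR t.
  move=> a1; have a10 : 0 < 1 + a by lra.
  have -> : expR t = (1 + a) * expR (t - ln (1 + a)).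
    by rewrite expRD expRN lnK ?posrE//; field; lra.
  rewrite ler_pM2l//; apply: le_trans (expR_ge1Dx _).
  have : ln (1 + a) <= a.
    by rewrite -[leRHS]expRK ler_ln ?posrE ?expR_gt0//; exact: expR_ge1Dx.
  lra.
have [t0|t0] := leP 0 t.
  by rewrite ger0_norm//; have := tangent s; nra.
by rewrite ltr0_norm//; have := tangent (- s); nra.
Qed.

Lemma norm_expRB (a c L : R) : a <= L -> c <= L ->
  `|expR a - expR c| <= expR L * `|a - c|.
Proof.
have key (p q : R) : p <= L -> expR p - expR q <= expR L * `|p - q|.
  move=> pL; have -> : expR q = expR p * expR (q - p).
    by rewrite -expRD; congr expR; ring.
  have h1 := expR_ge1Dx (q - p); have h2 := expR_gt0 p.
  have h3 : expR p <= expR L by rewrite ler_expR.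
  have h4 := ler_norm (p - q); have h5 := normr_ge0 (p - q).
  nra.
move=> aL cL; rewrite ler_norml; have := key a c aL; have := key c a cL.
by rewrite [`|c - a|]distrC => h1 h2; apply/andP; split; lra.
Qed.

(** For an almost maximiser [v], no single Sinkhorn step gains more than
    [s ^+ 2], hence each $t_k=v_k-\mathrm{softmin}_k(v)$ is small in $L^1$.
    The simultaneous update [psi] differs, in its [j]-th marginal density, from
    the exact value $1$ of the update of [j] alone by an integral of
    $\sum_{k\ne j}|t_k|$ against a bounded kernel: integration turns $L^1$
    smallness into uniform smallness. *)
Lemma approximate_schrodinger (j0 : 'I_m) (delta : R) : 0 < delta ->
  exists psi, [/\ potentials psi,
    forall k y, `|psi k y| <= m%:R * (m%:R * (2 * B) + B) + B &
    forall j y, `|marg psi j y - 1| <= delta].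
Proof.
move=> delta0; set K := m%:R * (2 * B) + B.
have K0 : 0 <= K by rewrite addr_ge0// !mulr_ge0.
set K2 := m%:R * K + B; set L := expR (m%:R * K2 + B).
have L0 : 0 < L by exact: expR_gt0.
have KK2 : K <= K2.
  rewrite /K2 -[leLHS]addr0 lerD// ler_peMl// ler1n.
  exact: leq_trans (ltn_ord j0).
have m0 : 0 < m%:R :> R by rewrite ltr0n (leq_trans _ (ltn_ord j0)).
(* The second bound makes the final uniform error at most [delta]; the first
   one only ensures [s < 1]. *)
pose s := Num.min (2^-1) (delta / (L * m%:R * 2)).
have s0 : 0 < s by rewrite lt_min invr_gt0 ltr0n divr_gt0// !mulr_gt0.
have s1 : s < 1.
  by rewrite gt_min (_ : 2^-1 < 1)//; rewrite invf_lt1 ?ltr1n.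
have sdelta : L * (m%:R * (2 * s)) <= delta.
  have : s <= delta / (L * m%:R * 2) by rewrite ge_min lexx orbT.
  by rewrite ler_pdivlMr ?mulr_gt0//; lra.
have [v [pv vK vmax]] := approximate_maximizer j0 (exprn_gt0 2 s0).
pose t k y := v k y - softmin v k y.
have bsv k := bmeas_softmin mu mb k pv.
have bt k : bmeas (t k) by exact: bmeasB.
have tL1 k : mean (mu k) (fun y => `|t k y|) <= 2 * s.
  have := vmax _ (potentials_setp k pv (bsv k)).
  rewrite (dual_sinkhorn mu mb)// lerD2l => h.
  have bn := bmeas_norm (bt k).
  have : mean (mu k) (fun y => s * `|t k y| - s ^+ 2) <= s ^+ 2.
    apply: le_trans h; apply: le_mean.
    - apply: bmeasB; last exact: bmeas_cst.
      by apply: bmeasM => //; exact: bmeas_cst.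
    - exact: bmeasB (bmeasB (bmeas_marg mu mb k pv) (bmeas_cst 1)) (bt k).
    - by move=> y; rewrite (marg_softmin mu mb)//; exact: expR_gap.
  rewrite (meanB _ (bmeasM (bmeas_cst s) bn) (bmeas_cst _)) mean_cst (meanZl _ _ bn).
  by rewrite lerBlDr (_ : _ + _ = s * (2 * s)) ?ler_pM2l//; ring.
pose psi k := softmin v k.
exists psi; split => //.
  by move=> k y; apply: softmin_le.
have ppsi : potentials psi by move=> k; exact: bsv.
have psiK k y : `|psi k y| <= K2 by exact: softmin_le.
move=> j y.
have pv' := potentials_setp j pv (bsv j).
rewrite -(marg_sinkhorn mu mb j y pv) !margE.
rewrite -meanB; [|by apply: bmeas_upd; exact: bmeas_gibbs..].
have bS : bmeas (fun x : m.-tuple T => \sum_k `|t k (tnth x k)|).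
  by apply: bmeas_sum => k _; apply: (bmeas_tnth k (bmeas_norm (bt k))).
have bL := bmeasM (bmeas_cst L) bS.
apply: le_trans (le_norm_mean _ _) _.
  by apply: bmeasB; apply: bmeas_upd; exact: bmeas_gibbs.
apply: le_trans sdelta.
apply: (@le_trans _ _ (mean Q (fun x => L * \sum_k `|t k (tnth x k)|))).
  apply: le_mean => //.
    by apply: bmeas_norm; apply: bmeasB; apply: bmeas_upd; exact: bmeas_gibbs.
  move=> x; rewrite /gibbs.
  have Lle u z : (forall k y, `|u k y| <= K2) ->
      \sum_k u k (tnth z k) - b z <= m%:R * K2 + B.
    by move=> uK2; apply: le_trans (ler_norm _) (log_gibbs_le bB z uK2).
  apply: le_trans (norm_expRB (Lle _ _ psiK) (Lle _ _ _)) _.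
    move=> k z; rewrite /setp; case: ifP => _; first exact: psiK.
    exact: le_trans (vK _ _) KK2.
  rewrite ler_pM2l// opprB addrA subrK sum_upd sum_setp opprD addrACA subrr add0r.
  rewrite -sumrB [leRHS](bigD1 j)//= -[leLHS]add0r lerD//.
  apply: le_trans (ler_norm_sum _ _ _) _; apply: ler_sum => k _.
  by rewrite /t /psi distrC.
rewrite (meanZl _ _ bS) ler_pM2l// mean_sum; last first.
  by move=> k _; apply: (bmeas_tnth k (bmeas_norm (bt k))).
rewrite mulr_natl -[X in _ *+ X]card_ord -sumr_const.
apply: ler_sum => k _.
by rewrite (mean_tnth mu k (bmeas_norm (bt k))).
Qed.

End approximate_maximizer.

(** * Relative entropy *)

Section entropy_lower_bound.
Context {d : measure_display} {T : measurableType d} {R : realType}.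
Local Open Scope ereal_scope.
Local Open Scope charge_scope.

(** The larger function need not be integrable: the logarithmic density is not
    known to be. *)
Lemma ae_le_integral (mu : {measure set T -> \bar R}) (f g : T -> \bar R) :
  measurable_fun setT f -> measurable_fun setT g ->
  {ae mu, forall x, f x <= g x} -> \int[mu]_x f x <= \int[mu]_x g x.
Proof.
move=> mf mg fg; rewrite integralE [leRHS]integralE leeB//.
- apply: ae_ge0_le_integral => //; [exact: measurable_funepos..|].
  apply: filterS fg => x fg _; rewrite !funeposE.
  by rewrite ge_max !le_max fg lexx orbT.
- apply: ae_ge0_le_integral => //; [exact: measurable_funeneg..|].
  apply: filterS fg => x fg _; rewrite !funenegE.
  by rewrite ge_max !le_max leeN2 fg lexx orbT.
Qed.

Variables (P Q : probability T R).
Hypothesis PQ : P `<< Q.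

Local Notation f := ('d (charge_of_finite_measure P) '/d Q).
Local Notation fr := (fun x => fine (f x)).

Let PQ' : charge_of_finite_measure P `<< Q := PQ.

Let measurable_f : measurable_fun setT f.
Proof. exact: (measurable_int Q (Radon_Nikodym_integrable PQ')). Qed.

Lemma derivativeE x : f x = (fr x)%:E.
Proof. by rewrite fineK//; exact: Radon_Nikodym_fin_num. Qed.

Lemma measurable_derivative : measurable_fun setT (fr : T -> R).
Proof. exact: measurableT_comp. Qed.

Let measurable_fr_le0 : measurable_fun setT (fun x => fr x <= 0)%R.
Proof.
by apply: measurable_fun_ler; [exact: measurable_derivative|exact: measurable_cst].
Qed.

Lemma derivative_gt0 : {ae P, forall x, (0 < fr x)%R}.
Proof.
pose A := [set x | (fr x <= 0)%R].
have mA : measurable A.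
  by have := measurable_fr_le0 measurableT (Y := [set true]) I; rewrite setTI.
exists A; split => //; last by move=> x /= /negP; rewrite -leNgt.
apply/eqP; rewrite eq_le measure_ge0 andbT.
have -> : P A = \int[Q]_(x in A) f x.
  exact: (@Radon_Nikodym_integral _ _ _ (charge_of_finite_measure P) Q).
have fi : Q.-integrable A f.
  by apply: (integrableS measurableT) => //; exact: Radon_Nikodym_integrable.
rewrite -[leRHS](integral0 Q A); apply: le_integral => //; first exact: integrable0.
by move=> x; rewrite inE => Ax; rewrite derivativeE lee_fin.
Qed.

Lemma measurable_lne_derivative : measurable_fun setT (fun x => lne (f x)).
Proof.
apply: (eq_measurable_fun
  (fun x => if (fr x <= 0)%R then -oo else (ln (fr x))%:E)).
  by move=> x _; rewrite derivativeE.
apply: measurable_fun_ifT => //.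
apply/measurable_EFinP; apply: measurableT_comp => //.
exact: measurable_derivative.
Qed.

Lemma change_measure_nonneg (w : T -> R) : measurable_fun setT w ->
  (forall x, 0 <= w x)%R ->
  \int[P]_x (w x)%:E = \int[Q]_x ((w x)%:E * f x).
Proof.
move=> mw w0.
have mE : measurable_fun setT (EFin \o w) by exact/measurable_EFinP.
have E0 x : 0 <= (EFin \o w) x by rewrite lee_fin.
rewrite -(Radon_Nikodym_SigmaFinite.change_of_variables PQ E0 measurableT mE).
apply: ae_eq_integral => //.
- apply: emeasurable_funM => //.
  exact: measurable_int (Radon_Nikodym_SigmaFinite.f_integrable PQ).
- exact: emeasurable_funM.
- by apply: ae_eqe_mul2l; exact: ae_eq_Radon_Nikodym_SigmaFinite.
Qed.

(** Fenchel--Young inequality for the relative entropy: integrate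
    $\log f\ge h+1-e^h/f$, where $f=dP/dQ$, against $P$. *)
Lemma entropy_ge (h : T -> R) : bmeas h ->
  (mean P h + 1 - mean Q (fun x => expR (h x)))%:E <= \int[P]_x lne (f x).
Proof.
move=> bh; have be := bmeas_exp bh.
pose w x := (if (fr x <= 0)%R then 0 else expR (h x - ln (fr x)))%R.
have w0 x : (0 <= w x)%R by rewrite /w; case: ifPn => // _; exact: expR_ge0.
have mw : measurable_fun setT w.
  apply: measurable_fun_ifT => //.
  apply: (measurableT_comp (@measurable_expR R)).
  apply: measurable_funB; first exact: bmeas_measurable.
  by apply: measurableT_comp => //; exact: measurable_derivative.
have mwE : measurable_fun setT (EFin \o w) by exact/measurable_EFinP.
have wf x : (w x)%:E * f x =
    (if (fr x <= 0)%R then 0 else expR (h x))%:E.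
  rewrite derivativeE /w; case: ifPn => [_|]; first by rewrite mul0e.
  by rewrite -ltNge => fr0; rewrite -EFinM expRB lnK ?posrE// divfK// gt_eqF.
have wE : \int[P]_x (w x)%:E <= (mean Q (fun x => expR (h x)))%:E.
  rewrite (change_measure_nonneg mw w0) -meanE//.
  apply: ge0_le_integral => //.
  - by move=> x _; rewrite wf lee_fin; case: ifPn => // _; exact: expR_ge0.
  - exact: emeasurable_funM.
  - exact/measurable_EFinP/bmeas_measurable.
  - by move=> x _; rewrite wf lee_fin; case: ifPn => // _; exact: expR_ge0.
have iw : P.-integrable setT (EFin \o w).
  apply/integrableP; split => //.
  under eq_integral do rewrite /= ger0_norm//.
  by apply: le_lt_trans wE _; rewrite ltry.
have bh1 : bmeas (fun x => h x + 1)%R by apply: bmeasD => //; exact: bmeas_cst.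
have ih := bmeas_integrable P bh1.
apply: (@le_trans _ _ (\int[P]_x ((h x + 1)%:E - (w x)%:E))).
  rewrite (integralB measurableT ih iw) [X in X - _](meanE P bh1).
  rewrite (meanD _ bh (bmeas_cst 1%R)) mean_cst EFinB leeB//.
apply: ae_le_integral.
- by apply: emeasurable_funB => //; exact: measurable_int ih.
- exact: measurable_lne_derivative.
- apply: filterS derivative_gt0 => x fr0.
  rewrite derivativeE lne_EFin// -EFinB lee_fin /w.
  have -> : (fr x <= 0)%R = false by apply/negbTE; rewrite -ltNge.
  have := expR_ge1Dx (h x - ln (fr x)); lra.
Qed.

End entropy_lower_bound.

Lemma KL_ge {d : measure_display} {T : measurableType d} {R : realType}
    (P Q : probability T R) (h : T -> R) : bmeas h ->
  ((mean P h + 1 - mean Q (fun x => expR (h x)))%:E <= KL P Q)%E.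
Proof.
move=> bh; rewrite /KL; case: ifPn => [/asboolP PQ|_]; last exact: leey.
exact: entropy_ge.
Qed.

(** Union bound for the complements, written with indicators. *)
Lemma probability_bigcap1 {d : measure_display} {T : measurableType d}
    {R : realType} (P : probability T R) (I : finType) (A : I -> set T) :
  (forall i, measurable (A i)) -> (forall i, P (A i) = 1%E) ->
  P (\bigcap_i A i) = 1%E.
Proof.
move=> mA PA; have mI : measurable (\bigcap_i A i).
  by apply: fin_bigcap_measurable => // i _; exact: mA.
have bA i : bmeas (fun x => 1 - \1_(A i) x : R).
  by apply: bmeasB; [exact: bmeas_cst|exact: bmeas_indic].
have : mean P (fun x => 1 - \sum_i (1 - \1_(A i) x)) <= mean P \1_(\bigcap_i A i).
  apply: le_mean.
  - by apply: bmeasB; [exact: bmeas_cst|apply: bmeas_sum => i _].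
  - exact: bmeas_indic.
  - move=> x; rewrite indicE; have [xI|/negP xI] := boolP (x \in _).
      rewrite gerBl; apply: sumr_ge0 => i _.
      by rewrite indicE; case: (_ \in _) => /=; lra.
    have [i Aix] : exists i, ~ A i x.
      apply: contrapT => /forallNP nA; apply: xI; rewrite inE => i _.
      exact: contrapT (nA i).
    rewrite subr_le0 (bigD1 i)//= indicE memNset// subr0 lerDl.
    apply: sumr_ge0 => k _; rewrite indicE; case: (_ \in _) => /=; lra.
rewrite (meanB _ (bmeas_cst 1)); last by apply: bmeas_sum => i _.
rewrite mean_cst mean_sum// big1; last first.
  move=> i _; rewrite (meanB _ (bmeas_cst 1) (bmeas_indic (mA i))) mean_cst.
  by rewrite mean_indic// PA subrr.
rewrite subr0 mean_indic// => h; apply/eqP; rewrite eq_le probability_le1//=.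
by rewrite -(fineK (fin_num_measure P _ mI)) lee_fin.
Qed.

Section density.
Context {d : measure_display} {T : measurableType d} {R : realType}.
Variables (Q : probability T R) (f : T -> R).

Definition density of bmeas f & (forall x, 0 <= f x) & mean Q f = 1 :
  set T -> \bar R := fun A => (\int[Q]_(x in A) (f x)%:E)%E.

Hypotheses (bf : bmeas f) (f0 : forall x, 0 <= f x) (f1 : mean Q f = 1).
Local Notation P := (density bf f0 f1).

Let P0 : P set0 = 0%E. Proof. exact: integral_set0. Qed.

Let P_ge0 A : (0 <= P A)%E.
Proof. by apply: integral_ge0 => x _; rewrite lee_fin. Qed.

Let P_sigma_additive : semi_sigma_additive P.
Proof.
apply: semi_sigma_additive_nng_induced => [|x]; last by rewrite lee_fin.
exact/measurable_EFinP/bmeas_measurable.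
Qed.

HB.instance Definition _ :=
  isMeasure.Build _ _ _ P P0 P_ge0 P_sigma_additive.

Let P_setT : P [set: T] = 1%E.
Proof. by rewrite /density meanE// f1. Qed.

HB.instance Definition _ := Measure_isProbability.Build _ _ _ P P_setT.

Definition density_probability : probability T R := P.

Lemma density_dominated : density_probability `<< Q.
Proof.
apply/null_content_dominatesP => A mA QA0 /=.
apply: null_set_integral => //.
exact/measurable_funTS/measurable_EFinP/bmeas_measurable.
Qed.

(** Both functions have the same integral over every measurable set. *)
Lemma density_derivative : ae_eq Q setT (EFin \o f)
  (Radon_Nikodym (charge_of_finite_measure density_probability) Q).
Proof.
have dom : charge_of_finite_measure density_probability `<< Q.
  exact: density_dominated.
apply: integral_ae_eq => //.
- exact: bmeas_integrable.
- by move=> A _ mA; rewrite -(Radon_Nikodym_integral dom mA).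
Qed.

Lemma mean_density g : bmeas g ->
  mean density_probability g = mean Q (fun x => g x * f x).
Proof.
move=> bg; have bgf := bmeasM bg bf.
apply: EFin_inj; rewrite -(meanE _ bg) -(meanE _ bgf).
have ig := bmeas_integrable density_probability bg.
rewrite -(Radon_Nikodym_change_of_variables density_dominated measurableT ig).
have dom : charge_of_finite_measure density_probability `<< Q.
  exact: density_dominated.
have mRN := measurable_int Q (Radon_Nikodym_integrable dom).
have mg : measurable_fun setT (EFin \o g).
  exact/measurable_EFinP/bmeas_measurable.
apply: ae_eq_integral => //.
- exact: emeasurable_funM.
- exact/measurable_EFinP/bmeas_measurable.
- apply: (ae_eq_trans (g := (EFin \o g) \* (EFin \o f))%E).
    exact/ae_eqe_mul2l/ae_eq_sym/density_derivative.
  by apply: aeW => x _ /=; rewrite EFinM.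
Qed.

Lemma KL_density (c : R) : 0 < c -> (forall x, c <= f x) ->
  KL density_probability Q = (mean density_probability (fun x => ln (f x)))%:E.
Proof.
move=> c0 cf; have bl := bmeas_ln bf c0 cf.
rewrite /KL; case: ifPn => [_|/asboolP []]; last exact: density_dominated.
rewrite -meanE//; apply: ae_eq_integral => //.
- exact: measurable_lne_derivative density_dominated.
- exact/measurable_EFinP/bmeas_measurable.
- have := null_dominates_ae_eq measurableT density_dominated density_derivative.
  apply: filterS => x /(_ I) fx _; rewrite -fx.
  rewrite -[(EFin \o f) x]/((f x)%:E) lne_EFin//.
  exact: lt_le_trans (cf x).
Qed.

End density.

(** * Duality for the entropic cost *)

Section EMOT_bounds.
Context {d : measure_display} {T : measurableType d} {R : realType} {m : nat}.
Variables (X : 'I_m -> set T) (c : m.-tuple T -> R) (eps B : R).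
Hypotheses (eps0 : 0 < eps) (mX : forall j, measurable (X j)).

(** Extended by zero, the cost becomes bounded and measurable on the whole space
    of tuples, and all integrals can be taken there. *)
Definition scaled_cost (x : m.-tuple T) : R := (c \_ (prod_set X)) x / eps.

Local Notation b := scaled_cost.
Hypotheses (mb : bmeas b) (bB : forall x, `|b x| <= B).
Variable mu : 'I_m -> probability T R.

Local Notation Q := (product_probability mu).

Lemma integral_cost (pi : probability (m.-tuple T) R) :
  (\int[pi]_(x in prod_set X) (c x)%:E)%E = (eps * mean pi b)%:E.
Proof.
rewrite -meanZl// -meanE; last by apply: bmeasM => //; exact: bmeas_cst.
rewrite integral_mkcond; apply: eq_integral => x _.
rewrite restrict_EFin /= /scaled_cost; congr EFin.
by rewrite mulrC divfK// gt_eqF.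
Qed.

Lemma mean_marginal (pi : probability (m.-tuple T) R) j (f : T -> R) :
  (forall A, measurable A -> pi ((@tnth _ T)^~ j @^-1` A) = mu j A) ->
  bmeas f -> mean pi (fun x => f (tnth x j)) = mean (mu j) f.
Proof.
move=> pij bf; have [Pg [PgE <-//]] := image_probability pi (measurable_tnth j).
by apply: eq_prob_mean => A mA; rewrite PgE pij.
Qed.

(** Weak duality: take $h=\sum_k u_k-b$ in the Fenchel--Young inequality; the
    marginal constraints evaluate $\int\sum_k u_k\,d\pi$. *)
Lemma EMOT_ge_dual u : potentials u ->
  ((eps * dual mu b u)%:E <= EMOT X c eps mu)%E.
Proof.
move=> pu; apply: le_ereal_inf_tmp => _ [pi [_ pimu] <-].
have bl := bmeas_log_gibbs mb pu.
have bs := bmeas_sum_tnth pu.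
rewrite integral_cost.
apply: (@le_trans _ _ ((eps * mean pi b)%:E + eps%:E *
    (mean pi (fun x => (\sum_k u k (tnth x k) - b x)) + 1 -
     mean Q (gibbs b u))%:E)%E); last first.
  by rewrite leeD2l// lee_wpmul2l ?lee_fin ?(ltW eps0)//; exact: KL_ge.
rewrite -EFinM -EFinD lee_fin -mulrDr ler_pM2l// dualE.
rewrite (meanB _ bs mb) mean_sum; last by move=> k _; exact: bmeas_tnth.
have -> : \sum_k mean pi (fun x => u k (tnth x k)) =
    \sum_k mean (mu k) (u k).
  by apply: eq_bigr => k _; exact: mean_marginal (pimu k) (pu k).
by rewrite le_eqVlt; apply/orP; left; apply/eqP; ring.
Qed.

(** Primal competitor: a Gibbs density whose marginals are uniformly close
    to those of [mu] becomes an exact coupling after an additive correction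
    by functions of one coordinate. *)
Lemma EMOT_le_potentials (j0 : 'I_m) psi (K delta : R) :
  (forall j, mu j (X j) = 1%E) -> potentials psi ->
  (forall k y, `|psi k y| <= K) ->
  (forall j y, `|marg mu b psi j y - 1| <= delta) ->
  4 * (m%:R * delta) <= expR (- (m%:R * K + B)) ->
  (EMOT X c eps mu <= (eps * (\sum_k mean (mu k) (psi k) +
     2 * (m%:R * delta) / expR (- (m%:R * K + B))))%:E)%E.
Proof.
move=> muX ppsi psiK margdelta.
set kappa := expR _ => deltak.
have k0 : 0 < kappa by exact: expR_gt0.
have m1 : 1 <= m%:R :> R by rewrite ler1n (leq_trans _ (ltn_ord j0)).
set g := gibbs b psi; have bg : bmeas g := bmeas_gibbs mb ppsi.
have gk x : kappa <= g x.
  rewrite /g /gibbs ler_expR.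
  by have := log_gibbs_le bB x psiK; rewrite ler_norml => /andP[].
pose r k y := 1 - marg mu b psi k y.
have br k : bmeas (r k).
  by apply: bmeasB; [exact: bmeas_cst|exact: bmeas_marg].
set a := mean Q g.
have mr k : mean (mu k) (r k) = 1 - a.
  rewrite (meanB _ (bmeas_cst 1) (bmeas_marg mu mb k ppsi)) mean_cst.
  by rewrite mean_marg.
have rdelta k y : `|r k y| <= delta by rewrite distrC.
have adelta : `|1 - a| <= delta by rewrite -(mr j0); exact: norm_mean_le.
have delta0 : 0 <= delta by exact: le_trans (normr_ge0 _) adelta.
(* Each marginal density of the Gibbs measure lacks [r j]; the other [m - 1]
   terms of the sum contribute the constant subtracted at the end. *)
pose s x := \sum_k r k (tnth x k) - (m%:R - 1) * (1 - a).
have bsr := bmeas_sum_tnth br.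
have bs : bmeas s by apply: bmeasB => //; exact: bmeas_cst.
have sdelta x : `|s x| <= 2 * (m%:R * delta).
  apply: le_trans (ler_normB _ _) _.
  have h1 := norm_sum_tnth x rdelta.
  have h2 : `|(m%:R - 1) * (1 - a)| <= m%:R * delta.
    by rewrite normrM ler_pM// ger0_norm ?subr_ge0// gerBl.
  by rewrite mulr_natl mulr2n lerD.
pose f x := g x + s x.
have bf : bmeas f by exact: bmeasD.
have fk x : kappa / 2 <= f x.
  have := sdelta x; have := gk x; rewrite ler_norml /f => h1 /andP[h2 _].
  by move: h1 h2 deltak; clear; lra.
have f0 x : 0 <= f x by apply: le_trans (fk x); rewrite divr_ge0// ltW.
have fupd j y : mean Q (fun x => f (upd j y x)) = 1.
  rewrite (meanD _ (bmeas_upd j y bg) (bmeas_upd j y bs)) -margE.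
  have -> : mean Q (fun x => s (upd j y x)) =
      mean Q (fun x => r j y - (m%:R - 1) * (1 - a) +
                       \sum_(k | k != j) r k (tnth x k)).
    by apply: eq_mean => x; rewrite /s sum_upd addrAC.
  have bk k : bmeas (fun x : m.-tuple T => r k (tnth x k)) by exact: bmeas_tnth.
  rewrite (meanD _ (bmeas_cst _)); last by apply: bmeas_sum => k _.
  rewrite mean_cst mean_sum// (eq_bigr (fun=> 1 - a)); last first.
    by move=> k _; rewrite mean_tnth.
  rewrite sumr_const (_ : #|_| = m.-1); last by rewrite cardC1 card_ord.
  have -> : (1 - a) *+ m.-1 = (m%:R - 1) * (1 - a).
    rewrite -[LHS]mulr_natl -subn1 natrB//.
    exact: leq_trans (ltn_ord j0).
  rewrite /r.
  by rewrite subrK addrC subrK.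
have f1 : mean Q f = 1.
  by rewrite (mean_resample _ j0 bf) -[RHS](mean_cst (mu j0)); exact: eq_mean.
pose pi := density_probability bf f0 f1.
have pimarg j A : measurable A -> pi ((@tnth _ T)^~ j @^-1` A) = mu j A.
  move=> mA.
  have mA' : measurable ((@tnth m T)^~ j @^-1` A).
    by rewrite -[X in measurable X]setTI; exact: measurable_tnth.
  rewrite !mean_indicE// mean_density; last exact: bmeas_indic.
  rewrite (mean_mul_tnth mu j (bmeas_indic mA) bf); congr EFin.
  by apply: eq_mean => y; rewrite fupd mulr1.
have pic : couplings X mu pi.
  split => //.
  rewrite prod_set_bigcap; apply: probability_bigcap1 => j; last by rewrite pimarg.
  by rewrite -[X in measurable X]setTI; exact: measurable_tnth.
apply: (@le_trans _ _ ((eps * mean pi b)%:E + eps%:E * KL pi Q)%E).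
  apply: ereal_inf_lbound; exists pi => //.
  by rewrite integral_cost.
have k20 : 0 < kappa / 2 by rewrite divr_gt0.
have bln := bmeas_ln bf k20 fk.
rewrite (KL_density bf f0 f1 k20 fk) -EFinM -EFinD lee_fin -mulrDr ler_pM2l//.
rewrite -(meanD _ mb bln).
set e := 2 * (m%:R * delta) / kappa.
have bpsi := bmeas_sum_tnth ppsi.
apply: (@le_trans _ _ (mean pi (fun x => \sum_k psi k (tnth x k) + e))).
  apply: le_mean; [exact: bmeasD|exact: bmeasD bpsi (bmeas_cst _)|] => x.
  have gx0 : 0 < g x := lt_le_trans k0 (gk x).
  have fx0 : 0 < f x := lt_le_trans k20 (fk x).
  have -> : \sum_k psi k (tnth x k) = ln (g x) + b x.
    by rewrite /g /gibbs expRK subrK.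
  rewrite [leRHS]addrAC [leLHS]addrC lerD2r -lerBlDl -ln_div ?posrE//.
  have fg : f x / g x <= 1 + e.
    rewrite /f mulrDl divff ?gt_eqF// lerD2l.
    apply: le_trans (ler_norm _) _; rewrite normrM normfV (gtr0_norm gx0).
    by rewrite ler_pM ?invr_ge0 ?lef_pV2 ?posrE// ltW.
  rewrite -[leRHS]expRK ler_ln ?posrE ?divr_gt0 ?expR_gt0//.
  exact: le_trans fg (expR_ge1Dx _).
rewrite (meanD _ bpsi (bmeas_cst e)) mean_cst lerD2r.
rewrite mean_sum; last by move=> k _; exact: bmeas_tnth.
apply: ler_sum => k _.
by rewrite (mean_marginal (pimarg k) (ppsi k)).
Qed.

End EMOT_bounds.

(** * Stability of the cost under a change of marginals *)

Lemma stability_arith (R : realFieldType)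
    (sm sn Lm Ln Lpsi gn gm gpsi delta G D KG L : R) :
  sn <= Ln + delta -> sm <= Lpsi + delta ->
  Ln + 1 - gn <= sn -> Lm + 1 - gm <= sm ->
  - delta <= gn - 1 <= delta -> - delta <= gpsi - 1 <= delta ->
  - G <= gm - 1 <= G -> Lpsi + 1 - gpsi <= Lm + 1 - gm + D ->
  D <= 2 * KG -> - L <= Lm - Ln <= L -> 0 < delta -> 0 <= G -> 0 <= KG ->
  - (L + (G + 2 * KG) + 3 * delta) <= sm - sn <= L + (G + 2 * KG) + 3 * delta.
Proof.
move=> h1 h2 h3 h4 /andP[h5 h6] /andP[h7 h8] /andP[h9 h10] h11 h12 /andP[h13 h14].
by move=> h15 h16 h17; apply/andP; split; lra.
Qed.

(** A first Sinkhorn sweep gives potentials bounded by $m\cdot2B+B$, and the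
    simultaneous update takes $K$ to $mK+B$. *)
Definition potential_bound {R : realType} (m : nat) (B : R) : R :=
  m%:R * (m%:R * (2 * B) + B) + B.

Section stability.
Context {d : measure_display} {T : measurableType d} {R : realType} {m : nat}.

(** Concavity of the dual functional, whose gradient at [phi] is given by the
    defects $1-a_k$ of the marginal densities. *)
Lemma dual_le_tangent (mu : 'I_m -> probability T R) (b : m.-tuple T -> R)
    (phi psi : 'I_m -> T -> R) : bmeas b -> potentials phi -> potentials psi ->
  dual mu b psi <= dual mu b phi + \sum_k mean (mu k)
    (fun y => (1 - marg mu b phi k y) * (psi k y - phi k y)).
Proof.
move=> mb pphi ppsi.
set Q := product_probability mu.
pose h k y := psi k y - phi k y.
have bh : potentials h by move=> k; exact: bmeasB.
have bphi := bmeas_gibbs mb pphi; have bpsi := bmeas_gibbs mb ppsi.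
have bhk k : bmeas (fun x : m.-tuple T => h k (tnth x k) * gibbs b phi x).
  by apply: bmeasM => //; exact: bmeas_tnth.
have bsum : bmeas (fun x : m.-tuple T => \sum_k h k (tnth x k) * gibbs b phi x).
  by apply: bmeas_sum => k _.
have le : mean Q (fun x => gibbs b phi x + \sum_k h k (tnth x k) * gibbs b phi x)
    <= mean Q (gibbs b psi).
  apply: le_mean => //; first exact: bmeasD.
  move=> x; rewrite -mulr_suml.
  have -> : gibbs b psi x = gibbs b phi x * expR (\sum_k h k (tnth x k)).
    rewrite /gibbs -expRD; congr expR.
    by rewrite /h sumrB; ring.
  rewrite -[X in X + _]mulr1 [X in _ + X]mulrC -mulrDr.
  by rewrite ler_pM2l ?expR_gt0//; exact: expR_ge1Dx.
move: le; rewrite (meanD _ bphi bsum) mean_sum//.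
have -> : \sum_k mean Q (fun x => h k (tnth x k) * gibbs b phi x) =
    \sum_k mean (mu k) (fun y => h k y * marg mu b phi k y).
  apply: eq_bigr => k _; rewrite (mean_mul_tnth mu k (bh k) bphi).
  by apply: eq_mean => y; rewrite margE.
have -> : \sum_k mean (mu k)
    (fun y => (1 - marg mu b phi k y) * (psi k y - phi k y)) =
  \sum_k mean (mu k) (psi k) - \sum_k mean (mu k) (phi k) -
  \sum_k mean (mu k) (fun y => h k y * marg mu b phi k y).
  rewrite -!sumrB; apply: eq_bigr => k _.
  have bM := bmeasM (bh k) (bmeas_marg mu mb k pphi).
  rewrite -(meanB _ (ppsi k) (pphi k)) -(meanB _ (bh k) bM).
  by apply: eq_mean => y; rewrite /h; ring.
rewrite !dualE -/Q.
move: (mean Q _) (mean Q _) (\sum_k _) (\sum_k _) (\sum_k _) => p q r s t.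
by clear; lra.
Qed.

Variables (X : 'I_m -> set T) (c : m.-tuple T -> R) (eps B : R) (j0 : 'I_m).
Hypotheses (eps0 : 0 < eps) (mX : forall j, measurable (X j)).
Local Notation b := (scaled_cost X c eps).
Hypotheses (mb : bmeas b) (bB : forall x, `|b x| <= B).

Local Notation K := (potential_bound m B).

Let m1 : 1 <= m%:R :> R.
Proof. by rewrite ler1n (leq_trans _ (ltn_ord j0)). Qed.

Lemma potential_bound_ge0 : 0 <= K.
Proof.
have B0 : 0 <= B := le_trans (normr_ge0 _) (bB point).
by rewrite addr_ge0// mulr_ge0// addr_ge0// !mulr_ge0.
Qed.

(** The three bounds on [e] ask for marginal densities within [delta] of one,
    for a positive corrected density, and for a primal excess at most
    [delta]. *)
Lemma near_optimal_potentials (mu : 'I_m -> probability T R) (delta : R) :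
  (forall j, mu j (X j) = 1%E) -> 0 < delta ->
  exists psi, [/\ potentials psi, forall k y, `|psi k y| <= K,
    forall j y, `|marg mu b psi j y - 1| <= delta &
    (EMOT X c eps mu <= (eps * (\sum_k mean (mu k) (psi k) + delta))%:E)%E].
Proof.
move=> muX delta0; pose kappa := expR (- (m%:R * K + B)).
have k0 : 0 < kappa by exact: expR_gt0.
have m0 : 0 < m%:R :> R by exact: lt_le_trans m1.
pose e := Num.min delta (Num.min (kappa / (4 * m%:R)) (delta * kappa / (2 * m%:R))).
have e0 : 0 < e by rewrite !lt_min delta0 !divr_gt0 ?mulr_gt0.
have ed : e <= delta by rewrite ge_min lexx.
have e1 : 4 * (m%:R * e) <= kappa.
  have : e <= kappa / (4 * m%:R) by rewrite /e !ge_min lexx !orbT.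
  by rewrite ler_pdivlMr ?mulr_gt0// => h; rewrite mulrA mulrC.
have e2 : 2 * (m%:R * e) / kappa <= delta.
  have : e <= delta * kappa / (2 * m%:R) by rewrite /e !ge_min lexx !orbT.
  rewrite ler_pdivlMr ?mulr_gt0// => h.
  by rewrite ler_pdivrMr// mulrA mulrC.
have [psi [ppsi psiK psim]] := approximate_schrodinger mu mb bB j0 e0.
exists psi; split => //; first by move=> j y; exact: le_trans (psim j y) ed.
apply: le_trans (EMOT_le_potentials eps0 mX mb bB j0 muX ppsi psiK psim e1) _.
by rewrite lee_fin ler_pM2l// lerD2l.
Qed.

Lemma EMOT_fin_num (mu : 'I_m -> probability T R) :
  (forall j, mu j (X j) = 1%E) -> EMOT X c eps mu \is a fin_num.
Proof.
move=> muX; have [psi [ppsi _ _ le]] := near_optimal_potentials muX (@ltr01 R).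
have ge := EMOT_ge_dual eps0 mb mu ppsi.
rewrite fin_real// (lt_le_trans _ ge) ?ltNyr//=.
by apply: le_lt_trans le _; rewrite ltry.
Qed.

(** Potentials of [mu] appear in the proof, through the concavity inequality,
    but only their uniform bound survives: the right-hand side depends on [mu]
    through averages of functions attached to [nu]. *)
Lemma EMOT_stability (nu : 'I_m -> probability T R) (delta : R) :
  (forall j, nu j (X j) = 1%E) -> 0 < delta ->
  exists phi, [/\ potentials phi, forall k y, `|phi k y| <= K,
    forall j y, `|marg nu b phi j y - 1| <= delta &
    forall mu : 'I_m -> probability T R, (forall j, mu j (X j) = 1%E) ->
      `|fine (EMOT X c eps mu) - fine (EMOT X c eps nu)| <= eps *
        (\sum_k `|mean (mu k) (phi k) - mean (nu k) (phi k)| +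
         (1 + 2 * K) * \sum_k mean (mu k) (fun y => `|marg mu b phi k y - 1|) +
         3 * delta)].
Proof.
move=> nuX delta0.
have [phi [pphi phiK phim nule]] := near_optimal_potentials nuX delta0.
exists phi; split => // mu muX.
have [psi [ppsi psiK psim mule]] := near_optimal_potentials muX delta0.
have nuge := EMOT_ge_dual eps0 mb nu pphi.
have muge := EMOT_ge_dual eps0 mb mu pphi.
have [sn snE] : exists s, EMOT X c eps nu = s%:E.
  by exists (fine (EMOT X c eps nu)); rewrite fineK//; exact: EMOT_fin_num.
have [sm smE] : exists s, EMOT X c eps mu = s%:E.
  by exists (fine (EMOT X c eps mu)); rewrite fineK//; exact: EMOT_fin_num.
move: nule nuge mule muge; rewrite {}snE {}smE !lee_fin /=.
move=> nule nuge mule muge.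
have mean_gibbs_le rho u : potentials u ->
    (forall j y, `|marg rho b u j y - 1| <= delta) ->
    `|mean (product_probability rho) (gibbs b u) - 1| <= delta.
  move=> pu um; rewrite -(mean_marg rho mb j0 pu) -[X in _ - X](mean_cst (rho j0)).
  have bm := bmeas_marg rho mb j0 pu.
  rewrite -(meanB _ bm (bmeas_cst 1)); apply: norm_mean_le => //.
  exact: bmeasB bm (bmeas_cst 1).
have h1 := mean_gibbs_le nu phi pphi phim.
have h2 := mean_gibbs_le mu psi ppsi psim.
set G := \sum_k mean (mu k) (fun y => `|marg mu b phi k y - 1|).
have bM k := bmeasB (bmeas_marg mu mb k pphi) (bmeas_cst 1).
have h3 : `|mean (product_probability mu) (gibbs b phi) - 1| <= G.
  rewrite -(mean_marg mu mb j0 pphi) -[X in _ - X](mean_cst (mu j0)).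
  rewrite -(meanB _ (bmeas_marg mu mb j0 pphi) (bmeas_cst 1)).
  apply: le_trans (le_norm_mean _ (bM j0)) _.
  rewrite /G (bigD1 j0)//= lerDl; apply: sumr_ge0 => k _.
  by apply: mean_ge0.
have h4 := dual_le_tangent mu mb pphi ppsi.
set D := \sum_k mean (mu k) (fun y => (1 - _) * _) in h4.
have K0 := potential_bound_ge0.
have h5 : D <= 2 * K * G.
  rewrite /G mulr_sumr; apply: ler_sum => k _.
  rewrite -(meanZl _ _ (bmeas_norm (bM k))); apply: le_mean.
  - apply: bmeasM (bmeasB (ppsi k) (pphi k)).
    exact: bmeasB (bmeas_cst 1) (bmeas_marg mu mb k pphi).
  - exact: bmeasM (bmeas_cst _) (bmeas_norm (bM k)).
  - move=> y; apply: le_trans (ler_norm _) _.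
    rewrite normrM [X in X * _]distrC mulrC ler_wpM2r//.
    apply: le_trans (ler_normB _ _) _.
    by rewrite mulr_natl mulr2n lerD.
have G0 : 0 <= G by exact: le_trans (normr_ge0 _) h3.
set L := \sum_k `|_|.
have h6 : `|\sum_k mean (mu k) (phi k) - \sum_k mean (nu k) (phi k)| <= L.
  by rewrite -sumrB; exact: ler_norm_sum.
have KG0 : 0 <= K * G by exact: mulr_ge0.
have -> : (1 + 2 * K) * G = G + 2 * (K * G) by ring.
rewrite -mulrA in h5.
rewrite !dualE in nuge muge h4.
suff : `|sm / eps - sn / eps| <= L + (G + 2 * (K * G)) + 3 * delta.
  by rewrite -mulrBl normrM normfV (gtr0_norm eps0) ler_pdivrMr// mulrC.
rewrite -!(mulrC (_ + _)) -?ler_pdivrMr// in nule mule.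
rewrite -!(mulrC (_ - _)) -?ler_pdivlMr// in nuge muge.
move: nule mule nuge muge h1 h2 h3 h4 h5 h6 delta0 G0 KG0.
rewrite !ler_norml.
exact: stability_arith.
Qed.

End stability.

(** * Laws of samples and empirical product measures *)

Section independent_families.
Context {d d' : measure_display} {Omega : measurableType d}
  {T : measurableType d'} {R : realType} {I : finType}.
Variables (P : probability Omega R) (xi : I -> {RV P >-> T})
  (rho : I -> probability T R).
Hypotheses (indep : mutually_independent xi)
  (law : forall i A, measurable A -> distribution P (xi i) A = rho i A).

Definition sample n (s : 'I_n -> I) (w : Omega) : n.-tuple T :=
  [tuple xi (s r) w | r < n].

Lemma measurable_sample n (s : 'I_n -> I) :
  measurable_fun [set: Omega] (sample s).
Proof.
apply/measurable_fun_tnthP => r.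
apply: (eq_measurable_fun (xi (s r))) => [w _ /=|]; last exact: measurable_funP.
by rewrite /sample tnth_mktuple.
Qed.

Lemma bmeas_sample n (s : 'I_n -> I) (f : n.-tuple T -> R) : bmeas f ->
  bmeas (fun w => f (sample s w)).
Proof. exact: (bmeas_comp (measurable_sample s)). Qed.

(** Injectivity of [s] says that no variable is used twice; the events needed
    for independence are indexed through a partial inverse of [s]. *)
Lemma mean_sample n (s : 'I_n -> I) (f : n.-tuple T -> R) : injective s ->
  bmeas f -> mean P (fun w => f (sample s w)) =
             mean (product_probability (rho \o s)) f.
Proof.
move=> sinj bf; have [Pg [PgE <-//]] := image_probability P (measurable_sample s).
apply: eq_prob_mean; apply: eq_probability_box => A mA.
rewrite PgE [RHS]product_probabilityE//.
pose A' j := if [pick i | s i == j] is Some i then A i else setT.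
have A's i : A' (s i) = A i.
  rewrite /A'; case: pickP => [k /eqP/sinj -> //|/(_ i)]; by rewrite eqxx.
have mA' j : measurable (A' j) by rewrite /A'; case: pickP.
have := indep [set s i | i in 'I_n]%SET mA'.
rewrite big_imset/=; last by move=> i k _ _; exact: sinj.
under eq_bigr do rewrite A's -[P _]/(distribution P (xi (s _)) _) law//.
rewrite (eq_bigl xpredT)// => <-; congr (P _).
apply/seteqP; split=> w /=.
  move=> Aw _ /imsetP[i _ ->]; rewrite /preimage/= A's.
  by have := Aw i; rewrite /sample tnth_mktuple.
move=> Aw i; rewrite /sample tnth_mktuple -A's; apply: Aw.
exact/imset_f.
Qed.

End independent_families.

Section product_split.
Context {d : measure_display} {T : measurableType d} {R : realType}.
Variables (m n : nat).

Definition split_tuple (z : (m + n).-tuple T) : m.-tuple T * n.-tuple T :=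
  ([tuple tnth z (lshift n r) | r < m], [tuple tnth z (rshift m r) | r < n]).

Definition join_tuple (p : m.-tuple T * n.-tuple T) : (m + n).-tuple T :=
  [tuple match fintype.split i with
         | inl r => tnth p.1 r
         | inr r => tnth p.2 r
         end | i < m + n].

Lemma join_tupleK : cancel join_tuple split_tuple.
Proof.
move=> [v w]; rewrite /split_tuple /join_tuple; congr pair;
  apply: eq_from_tnth => r; rewrite !tnth_mktuple.
- by rewrite (unsplitK (inl r)).
- by rewrite (unsplitK (inr r)).
Qed.

Lemma measurable_split_tuple : measurable_fun setT split_tuple.
Proof.
apply: measurable_fun_pair; apply/measurable_fun_tnthP => r.
- apply: (eq_measurable_fun (fun z => tnth z (lshift n r))) => [z _ /=|].
    by rewrite tnth_mktuple.
  exact: measurable_tnth.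
- apply: (eq_measurable_fun (fun z => tnth z (rshift m r))) => [z _ /=|].
    by rewrite tnth_mktuple.
  exact: measurable_tnth.
Qed.

Lemma measurable_join_tuple : measurable_fun setT join_tuple.
Proof.
apply/measurable_fun_tnthP => i.
apply: (eq_measurable_fun (fun p : m.-tuple T * n.-tuple T =>
  match fintype.split i with inl r => tnth p.1 r | inr r => tnth p.2 r end)).
  by move=> p _ /=; rewrite tnth_mktuple.
case: (fintype.split i) => r.
- exact: (measurableT_comp (measurable_tnth r) measurable_fst).
- exact: (measurableT_comp (measurable_tnth r) measurable_snd).
Qed.

Lemma mean_product_split (rho : 'I_(m + n) -> probability T R)
    (F : m.-tuple T * n.-tuple T -> R) : bmeas F ->
  mean (product_probability rho) (fun z => F (split_tuple z)) =
  mean (product_probability (rho \o @lshift m n)) (fun v =>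
    mean (product_probability (rho \o @rshift m n)) (fun w => F (v, w))).
Proof.
move=> bF; rewrite -mean_fubini//.
set Q1 := product_probability (rho \o @lshift m n).
set Q2 := product_probability (rho \o @rshift m n).
set Q := product_probability rho.
have [Pg [PgE meanPg]] := image_probability (Q1 \x Q2)%E measurable_join_tuple.
transitivity (mean Pg (fun z => F (split_tuple z))); last first.
  rewrite meanPg; last exact: (bmeas_comp measurable_split_tuple).
  by apply: eq_mean => p; rewrite join_tupleK.
apply: eq_prob_mean; apply: eq_probability_box => A mA.
rewrite PgE [LHS]product_probabilityE// big_split_ord/=.
rewrite (_ : _ @^-1` _ =
    prod_set (A \o @lshift m n) `*` prod_set (A \o @rshift m n)); last first.
  apply/seteqP; split => -[v w] /=.
    move=> Az; split=> r /=.
      by have := Az (lshift n r); rewrite /join_tuple tnth_mktuple (unsplitK (inl r)).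
    by have := Az (rshift m r); rewrite /join_tuple tnth_mktuple (unsplitK (inr r)).
  move=> [Av Aw] i; rewrite /join_tuple tnth_mktuple.
  by case: split_ordP => r ->; [exact: Av|exact: Aw].
transitivity (Q1 (prod_set (A \o @lshift m n)) * Q2 (prod_set (A \o @rshift m n)))%E.
  rewrite [Q1 _]product_probabilityE; last by move=> r; exact: mA.
  by rewrite [Q2 _]product_probabilityE//; move=> r; exact: mA.
by apply/esym/product_measure1E; apply: measurable_prod_set => r; exact: mA.
Qed.

End product_split.

Section empirical_means.
Context {d : measure_display} {T : measurableType d} {R : realType}.

Lemma mean_empirical N (x : 'I_N.+1 -> T) (f : T -> R) : bmeas f ->
  mean (empirical x) f = N.+1%:R^-1 * \sum_k f (x k).
Proof.
move=> bf.
have nonneg (g : T -> R) : measurable_fun setT g -> (forall y, 0 <= g y) ->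
    (\int[empirical x]_y (g y)%:E)%E = (N.+1%:R^-1 * \sum_k g (x k))%:E.
  move=> mg g0; have mE : measurable_fun setT (EFin \o g) by exact/measurable_EFinP.
  rewrite ge0_integral_mscale//; last by move=> y _; rewrite lee_fin.
  rewrite ge0_integral_measure_sum//; last by move=> y _; rewrite lee_fin.
  rewrite EFinM -sumEFin; congr (_ * _)%E; apply: eq_bigr => k _.
  by rewrite integral_dirac// diracT mul1e inord_val.
have [M M0 fM] := bmeas_bound bf.
have bfM := bmeasD bf (bmeas_cst M).
have fM0 y : 0 <= f y + M.
  by have := fM y; rewrite ler_norml => /andP[]; lra.
have := nonneg _ (bmeas_measurable bfM) fM0.
rewrite meanE// (meanD _ bf (bmeas_cst M)) mean_cst => -[h].
have {h}-> : mean (empirical x) f = N.+1%:R^-1 * \sum_k (f (x k) + M) - M.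
  by rewrite -h addrK.
rewrite big_split/= sumr_const card_ord mulrDr -(mulr_natr M) mulrCA mulVf ?pnatr_eq0//.
by rewrite mulr1 addrK.
Qed.

End empirical_means.

Section empirical_products.
Context {d : measure_display} {T : measurableType d} {R : realType}.

Lemma indic_prod_set m (A : 'I_m -> set T) (x : m.-tuple T) :
  \1_(prod_set A) x = \prod_j \1_(A j) (tnth x j) :> R.
Proof.
rewrite indicE; have [/[!inE] Ax|/negP xA] := boolP (x \in _).
  by rewrite big1// => j _; rewrite indicE mem_set.
have [j Ajx] : exists j, ~ A j (tnth x j).
  apply: contrapT => /forallNP nA; apply: xA; rewrite inE => j.
  exact: contrapT (nA j).
by rewrite (bigD1 j)//= indicE memNset// mul0r.
Qed.

(** The right-hand side is the mean for the empirical measure of all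
    combinations of sample points; on boxes it agrees with the product
    measure by expanding a product of sums. *)
Lemma mean_product_empirical m N (x : 'I_m -> 'I_N.+1 -> T)
    (f : m.-tuple T -> R) : bmeas f ->
  mean (product_probability (fun j => empirical (x j))) f =
  (N.+1 ^ m)%:R^-1 *
    \sum_(k : {ffun 'I_m -> 'I_N.+1}) f [tuple x r (k r) | r < m].
Proof.
move=> bf; pose V (k : {ffun 'I_m -> 'I_N.+1}) := [tuple x r (k r) | r < m].
have cardF : #|{: {ffun 'I_m -> 'I_N.+1}}| = (N.+1 ^ m)%N.
  by rewrite card_ffun !card_ord.
have [n nE] : exists n, #|{: {ffun 'I_m -> 'I_N.+1}}| = n.+1.
  by exists (N.+1 ^ m).-1; rewrite cardF prednK// expn_gt0.
pose y (t : 'I_n.+1) := V (enum_val (cast_ord (esym nE) t)).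
have meany (g : m.-tuple T -> R) : bmeas g ->
    mean (empirical y) g = (N.+1 ^ m)%:R^-1 * \sum_k g (V k).
  move=> bg; rewrite mean_empirical// -cardF nE; congr (_ * _).
  rewrite (big_enum_val (fun k => g (V k))) (reindex (cast_ord (esym nE)))//=.
  by exists (cast_ord nE) => t _; rewrite ?cast_ordK ?cast_ordKV.
rewrite -meany//; apply: eq_prob_mean; apply: eq_probability_box => A mA.
rewrite [LHS]product_probabilityE//.
have mbox : measurable (prod_set A) by exact: measurable_prod_set.
rewrite [RHS]mean_indicE// meany; last exact: bmeas_indic.
transitivity (\prod_j (N.+1%:R^-1 * \sum_i \1_(A j) (x j i) : R)%:E)%E.
  apply: eq_bigr => j _; rewrite [LHS]mean_indicE// mean_empirical//.
  exact: bmeas_indic.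
rewrite prodEFin big_split/= prodr_const card_ord exprVn natrX; congr (_ * _)%:E.
rewrite bigA_distr_bigA/=; apply: eq_bigr => k _; rewrite indic_prod_set.
by apply: eq_bigr => j _; rewrite tnth_mktuple.
Qed.

End empirical_products.

(** * Fluctuations of conditional means *)

Section sampling.
Context {d d' : measure_display} {Omega : measurableType d}
  {T : measurableType d'} {R : realType} {m N : nat}.
Variables (P : probability Omega R) (xi : 'I_m * 'I_N.+1 -> {RV P >-> T})
  (nu : 'I_m -> probability T R).
Hypotheses (indep : mutually_independent xi)
  (law : forall j k A, measurable A -> distribution P (xi (j, k)) A = nu j A).

Local Notation Q := (product_probability nu).
Local Notation F := {ffun 'I_m -> 'I_N.+1}.
Local Notation "'V' k" := (sample xi (fun r => (r, k r))) (at level 10).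

(** Two combinations without a common observation are independent: together they
    form a sample of length [m + m] of distinct variables. *)
Lemma mean_disjoint (k l : 'I_m -> 'I_N.+1)
    (f : m.-tuple T * m.-tuple T -> R) :
  (forall r, k r != l r) -> bmeas f ->
  mean P (fun w => f (V k w, V l w)) = mean Q (fun v => mean Q (fun u => f (v, u))).
Proof.
move=> kl bf.
pose s (i : 'I_(m + m)) := match fintype.split i with
  inl r => (r, k r) | inr r => (r, l r) end.
have sl r : s (lshift m r) = (r, k r) by rewrite /s (unsplitK (inl r)).
have sr r : s (rshift m r) = (r, l r) by rewrite /s (unsplitK (inr r)).
have sinj : injective s.
  move=> a b; case: (split_ordP a) => r ->; case: (split_ordP b) => t ->;
    rewrite ?sl ?sr => -[-> E] //; by have := kl t; rewrite E eqxx.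
have law' p A : measurable A -> distribution P (xi p) A = nu p.1 A.
  by case: p => j i; exact: law.
have := mean_sample indep law' sinj (bmeas_comp (@measurable_split_tuple _ _ m m) bf).
rewrite mean_product_split//.
rewrite (_ : _ \o @lshift m m = nu); last by apply/funext => r /=; rewrite sl.
rewrite (_ : _ \o @rshift m m = nu); last by apply/funext => r /=; rewrite sr.
move=> <-; apply: eq_mean => w; congr (f (_, _));
  apply: eq_from_tnth => r; by rewrite !tnth_mktuple ?sl ?sr.
Qed.

Definition setk (k : F) j i : F := [ffun r => if r == j then i else k r].

Lemma upd_sample j i (k : F) w :
  upd j (xi (j, i) w) (V k w) = V (setk k j i) w.
Proof.
apply: eq_from_tnth => r; rewrite tnth_upd !tnth_mktuple ffunE.
by case: eqP => // ->.
Qed.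

(** Square norm in $L^2(\hat\nu_j)$ of the conditional mean of [q] given the
    $j$-th coordinate, under the product of the empirical measures. *)
Definition conditional_sqr j (q : m.-tuple T -> R) (w : Omega) : R :=
  mean (empirical (fun k => xi (j, k) w)) (fun y =>
    mean (product_probability (fun r => empirical (fun k => xi (r, k) w)))
      (fun x => q (upd j y x)) ^+ 2).

Lemma conditional_sqrE j q w : bmeas q -> conditional_sqr j q w =
  N.+1%:R^-1 * \sum_i ((N.+1 ^ m)%:R^-1 * \sum_(k : F) q (V (setk k j i) w)) ^+ 2.
Proof.
move=> bq; rewrite /conditional_sqr mean_empirical; last first.
  by apply: bmeasX; exact: bmeas_mean_upd.
congr (_ * _); apply: eq_bigr => i _; congr (_ ^+ 2).
rewrite mean_product_empirical; last exact: bmeas_upd.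
by congr (_ * _); apply: eq_bigr => k _; rewrite -upd_sample.
Qed.

(** One value in [N.+1] is prescribed, so a fraction [1 / N.+1] of the
    combinations is selected. *)
Lemma sum_ffun_eq (r : 'I_m) (a : 'I_N.+1) :
  \sum_(l : F) (a == l r)%:R = (N.+1 ^ m)%:R / N.+1%:R :> R.
Proof.
pose g (s : 'I_m) (i : 'I_N.+1) : R := if s == r then (a == i)%:R else 1.
transitivity (\sum_(l : F) \prod_s g s (l s)).
  apply: eq_bigr => l _; rewrite (bigD1 r)//= /g eqxx big1 ?mulr1//.
  by move=> s /negbTE ->.
rewrite -bigA_distr_bigA (bigD1 r)//= [X in _ * X](eq_bigr (fun=> N.+1%:R)); last first.
  by move=> s /negbTE sr; rewrite /g sr sumr_const card_ord.
rewrite prodr_const cardC1 card_ord /g eqxx (bigD1 a)//= eqxx big1 ?addr0; last first.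
  by move=> i; rewrite eq_sym => /negbTE ->.
rewrite mul1r natrX -{2}(ltn_predK (ltn_ord r)) exprSr mulfK// pnatr_eq0//.
Qed.

Variables (j : 'I_m) (q : m.-tuple T -> R) (M delta : R).
Hypotheses (bq : bmeas q) (qM : forall x, `|q x| <= M)
  (qdelta : forall y, `|mean Q (fun x => q (upd j y x))| <= delta).

Lemma bmeas_conditional_sqr : bmeas (conditional_sqr j q).
Proof.
pose g w := N.+1%:R^-1 *
  \sum_i ((N.+1 ^ m)%:R^-1 * \sum_(k : F) q (V (setk k j i) w)) ^+ 2.
apply: (@eq_bmeas _ _ _ g); first by move=> w; rewrite conditional_sqrE.
apply: bmeasM; first exact: bmeas_cst.
apply: bmeas_sum => i _; apply: bmeasX; apply: bmeasM; first exact: bmeas_cst.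
by apply: bmeas_sum => k _; exact: bmeas_sample.
Qed.

Let M0 : 0 <= M. Proof. exact: le_trans (normr_ge0 _) (qM point). Qed.

Let delta0 : 0 <= delta. Proof. exact: le_trans (normr_ge0 _) (qdelta point). Qed.

(** The two combinations share the observation [(j, i)].  If that is their only
    overlap, the second one may be resampled off its $j$-th coordinate and
    integrates to at most [delta]; it is enough to compare the first one with
    [l], whose own $j$-th entry is overwritten. *)
Lemma covariance_le (k l : F) i :
  mean P (fun w => q (V (setk k j i) w) * q (V (setk l j i) w)) <=
  delta * M + M ^+ 2 * \sum_r (setk k j i r == l r)%:R.
Proof.
set k' := setk k j i.
have [kl|/existsP[r klr]] := boolP [forall r, k' r != l r]; last first.
  apply: (@le_trans _ _ (M ^+ 2)).
    apply: mean_le_cst; first by apply: bmeasM; exact: bmeas_sample.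
    move=> w; apply: le_trans (ler_norm _) _.
    by rewrite normrM expr2 ler_pM.
  rewrite -[leLHS]add0r lerD ?mulr_ge0// ler_peMr ?sqr_ge0//.
  rewrite (bigD1 r)//= (negPn klr) lerDl; apply: sumr_ge0 => s _.
  by case: (_ == _).
pose f (p : m.-tuple T * m.-tuple T) := q p.1 * q (upd j (tnth p.1 j) p.2).
have mt : measurable_fun setT (fun p : m.-tuple T * m.-tuple T => tnth p.1 j).
  exact: (measurableT_comp (measurable_tnth j) measurable_fst).
have mp := measurable_fun_pair mt measurable_snd.
have bf : bmeas f.
  apply: bmeasM; first exact: (bmeas_comp measurable_fst).
  exact: (bmeas_comp mp (bmeas_updE j bq)).
rewrite (_ : mean P _ = mean P (fun w => f (V k' w, V l w))); last first.
  apply: eq_mean => w; rewrite /f/=; congr (q _ * q _).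
  by rewrite -upd_sample tnth_mktuple /k' ffunE eqxx.
rewrite mean_disjoint//; last exact/forallP.
apply: (@le_trans _ _ (delta * M)); last first.
  by rewrite lerDl mulr_ge0 ?sqr_ge0//; apply: sumr_ge0 => r _; case: (_ == _).
apply: mean_le_cst; first exact: (bmeas_fubini Q Q bf).
move=> v; rewrite /f/= meanZl; last exact: bmeas_upd.
by apply: le_trans (ler_norm _) _; rewrite normrM mulrC ler_pM.
Qed.

(** Expanding the square gives an average of covariances over pairs of
    combinations; a union bound over coordinates shows that at most a fraction
    [m / N.+1] of the pairs overlap. *)
Lemma mean_conditional_sqr :
  mean P (conditional_sqr j q) <= delta * M + m%:R * M ^+ 2 / N.+1%:R.
Proof.
rewrite (eq_mean _ (fun w => conditional_sqrE j w bq)).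
set c := (N.+1 ^ m)%:R^-1.
have bV i (k : F) : bmeas (fun w => q (V (setk k j i) w)) by exact: bmeas_sample.
have bS i : bmeas (fun w => \sum_(k : F) q (V (setk k j i) w)).
  by apply: bmeas_sum => k _.
have bSX i : bmeas (fun w => (c * \sum_(k : F) q (V (setk k j i) w)) ^+ 2).
  by apply: bmeasX; apply: bmeasM => //; exact: bmeas_cst.
rewrite meanZl; last by apply: bmeas_sum => i _.
rewrite mean_sum//; set C := delta * M + _.
have -> : C = N.+1%:R^-1 * \sum_(i < N.+1) C.
  by rewrite sumr_const card_ord -(mulr_natr C) mulrCA mulVf ?mulr1// pnatr_eq0.
rewrite ler_pM2l ?invr_gt0 ?ltr0n//; apply: ler_sum => i _.
have c0 : 0 < c by rewrite invr_gt0 ltr0n expn_gt0.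
have cF : c * (N.+1 ^ m)%:R = 1 by rewrite mulVf// pnatr_eq0 -lt0n expn_gt0.
apply: (@le_trans _ _ (c * \sum_(k : F) (c * \sum_(l : F)
    (delta * M + M ^+ 2 * \sum_r (setk k j i r == l r)%:R)))).
  have -> : mean P (fun w => (c * \sum_(k : F) q (V (setk k j i) w)) ^+ 2) =
      c * \sum_(k : F) (c * \sum_(l : F)
        mean P (fun w => q (V (setk k j i) w) * q (V (setk l j i) w))).
    transitivity (mean P (fun w => c * \sum_(k : F) c * \sum_(l : F)
        q (V (setk k j i) w) * q (V (setk l j i) w))).
      apply: eq_mean => w; rewrite exprMn expr2 -mulrA; congr (_ * _).
      set S := \sum_k _; transitivity (\sum_(k : F) c * (q (V (setk k j i) w) * S)).
        by rewrite -mulr_sumr -mulr_suml expr2.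
      by apply: eq_bigr => k _; rewrite mulr_sumr.
    have bVV k l := bmeasM (bV i k) (bV i l).
    have bVVl k : bmeas (fun w =>
        \sum_(l : F) q (V (setk k j i) w) * q (V (setk l j i) w)).
      by apply: bmeas_sum => l _.
    rewrite meanZl; last first.
      by apply: bmeas_sum => k _; apply: bmeasM => //; exact: bmeas_cst.
    rewrite mean_sum; last first.
      by move=> k _; apply: bmeasM => //; exact: bmeas_cst.
    congr (_ * _); apply: eq_bigr => k _; rewrite meanZl// mean_sum//.
  rewrite ler_pM2l//; apply: ler_sum => k _; rewrite ler_pM2l//.
  by apply: ler_sum => l _; exact: covariance_le.
have inner (k : F) : c * \sum_(l : F)
    (delta * M + M ^+ 2 * \sum_r (setk k j i r == l r)%:R) =
    C.
  rewrite big_split/= sumr_const card_ffun !card_ord mulrDr.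
  rewrite -mulr_sumr exchange_big/=.
  rewrite (eq_bigr (fun=> (N.+1 ^ m)%:R / N.+1%:R)); last first.
    by move=> r _; exact: sum_ffun_eq.
  rewrite sumr_const card_ord -[_ *+ (N.+1 ^ m)]mulr_natr mulrCA cF mulr1.
  congr (_ + _); rewrite -[_ *+ m]mulr_natr.
  transitivity (c * (N.+1 ^ m)%:R * (m%:R * M ^+ 2 / N.+1%:R)); first by ring.
  by rewrite cF mul1r.
rewrite (eq_bigr _ (fun k _ => inner k)) sumr_const card_ffun !card_ord.
by rewrite -mulr_natr mulrCA cF mulr1.
Qed.

End sampling.

(** * The rate *)

(** The integral of a nonnegative function is a supremum over the simple
    functions below it, hence monotone without measurability.  The empirical
    cost, an infimum over couplings, need not be a measurable function of the
    sample. *)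
Lemma le_integral_majorant {d : measure_display} {T : measurableType d}
    {R : realType} (mu : {measure set T -> \bar R}) (f g : T -> \bar R) :
  (forall x, 0 <= f x)%E -> (forall x, f x <= g x)%E ->
  (\int[mu]_x f x <= \int[mu]_x g x)%E.
Proof.
move=> f0 fg; have g0 x : (0 <= g x)%E by exact: le_trans (fg x).
rewrite !ge0_integralTE//; apply: ereal_sup_le => _ [h hf <-].
by exists h => // x; exact: le_trans (hf x) (fg x).
Qed.

Lemma sqr_sum_le {R : realFieldType} {m : nat} (a : 'I_m -> R) :
  (\sum_k a k) ^+ 2 <= m%:R * \sum_k a k ^+ 2.
Proof.
rewrite expr2 mulr_suml.
apply: (@le_trans _ _ (\sum_k \sum_l (a k ^+ 2 + a l ^+ 2) / 2)).
  apply: ler_sum => k _; rewrite mulr_sumr; apply: ler_sum => l _.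
  by have := sqr_ge0 (a k - a l); nra.
rewrite le_eqVlt; apply/orP; left; apply/eqP.
have -> : \sum_k \sum_l (a k ^+ 2 + a l ^+ 2) / 2 =
    \sum_k (m%:R * a k ^+ 2 + \sum_l a l ^+ 2) / 2.
  apply: eq_bigr => k _; rewrite -mulr_suml big_split/= sumr_const card_ord.
  by rewrite -(mulr_natl (a k ^+ 2)).
rewrite -mulr_suml big_split/= -mulr_sumr sumr_const card_ord -[_ *+ m]mulr_natl.
by field.
Qed.

Lemma sqr_add3_le {R : realFieldType} (x y z : R) :
  (x + y + z) ^+ 2 <= 3 * (x ^+ 2 + y ^+ 2 + z ^+ 2).
Proof.
have := sqr_ge0 (x - y); have := sqr_ge0 (y - z); have := sqr_ge0 (x - z).
by nra.
Qed.

(** [L] bounds the Gibbs density minus one; the first two summands collect the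
    squared linear and marginal terms of the stability estimate, and the last
    one its slack, taken equal to [1 / N.+1]. *)
Definition rate_constant {R : realType} (m : nat) (B : R) : R :=
  let K := potential_bound m B in
  let L := expR (m%:R * K + B) + 1 in
  3 * (m%:R * (m%:R * (1 * (2 * K) + m%:R * (2 * K) ^+ 2)) +
       (1 + 2 * K) ^+ 2 * (m%:R * (m%:R * (1 * L + m%:R * L ^+ 2))) + 9).

Section expected_error.
Context {d d' : measure_display} {Omega : measurableType d}
  {T : measurableType d'} {R : realType} {m N : nat}.
Variables (X : 'I_m -> set T) (c : m.-tuple T -> R) (eps B : R).
Hypotheses (m2 : (2 <= m)%N) (eps0 : 0 < eps) (mX : forall j, measurable (X j)).
Local Notation b := (scaled_cost X c eps).
Hypotheses (mb : bmeas b) (bB : forall x, `|b x| <= B).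
Variables (P : probability Omega R) (xi : 'I_m * 'I_N.+1 -> {RV P >-> T})
  (nu : 'I_m -> probability T R).
Hypotheses (indep : mutually_independent xi)
  (law : forall j k A, measurable A -> distribution P (xi (j, k)) A = nu j A)
  (nuX : forall j, nu j (X j) = 1%E).

Local Notation K := (potential_bound m B).
Local Notation hat w :=
  (fun j : 'I_m => empirical (fun k => xi (j, k) w) : probability T R).

(** Off [G] the empirical measures may have no coupling carried by the supports,
    and the empirical cost is then infinite. *)
Lemma sample_in_support : exists2 G : set Omega, measurable G /\ P G = 1%E &
  forall w, G w -> forall j, hat w j (X j) = 1%E.
Proof.
have mG p : measurable (xi p @^-1` X p.1).
  by rewrite -[Y in measurable Y]setTI; exact: measurable_funP.
exists (\bigcap_p (xi p @^-1` X p.1)).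
  split; first by apply: fin_bigcap_measurable => // p _; exact: mG.
  apply: probability_bigcap1 => // -[j k].
  by rewrite -[LHS]/(distribution P (xi (j, k)) (X j)) law.
move=> w Gw j; rewrite [LHS]empiricalE.
rewrite (eq_bigr (fun=> 1%E)) => [|k _]; last first.
  by rewrite diracE mem_set//; exact: (Gw (j, k)).
by rewrite sumEFin sumr_const card_ord -EFinM mulVf// pnatr_eq0.
Qed.

Let j1 : 'I_m := Ordinal (ltnW m2).

Let other (j : 'I_m) : exists i : 'I_m, i != j.
Proof.
have [->|j1j] := eqVneq j j1; last by exists j1; rewrite eq_sym.
by exists (Ordinal m2).
Qed.

Let K0 : 0 <= K. Proof. exact: potential_bound_ge0 bB. Qed.

Lemma expected_error_majorant : exists W : Omega -> R,
  [/\ bmeas W, forall w, (forall j, hat w j (X j) = 1%E) ->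
    (fine (EMOT X c eps (hat w)) - fine (EMOT X c eps nu)) ^+ 2 <=
      eps ^+ 2 * W w &
  mean P W <= rate_constant m B / N.+1%:R].
Proof.
set delta := N.+1%:R^-1 : R.
have d0 : 0 < delta by rewrite invr_gt0.
have d1 : delta <= 1 by rewrite invf_le1// ler1n.
have [phi [pphi phiK phim stab]] := EMOT_stability j1 eps0 mX mb bB nuX d0.
set L := expR (m%:R * K + B) + 1.
pose p (x : m.-tuple T) := gibbs b phi x - 1.
have bg := bmeas_gibbs mb pphi.
have bp : bmeas p by exact: bmeasB bg (bmeas_cst 1).
have pL x : `|p x| <= L.
  apply: le_trans (ler_normB _ _) _; rewrite normr1 lerD2r.
  rewrite ger0_norm ?expR_ge0// ler_expR.
  exact: le_trans (ler_norm _) (log_gibbs_le bB x phiK).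
have mp mu j y : mean (product_probability mu) (fun x => p (upd j y x)) =
    marg mu b phi j y - 1.
  by rewrite (meanB _ (bmeas_upd j y bg) (bmeas_cst 1)) mean_cst margE.
have pdelta j y : `|mean (product_probability nu) (fun x => p (upd j y x))| <= delta.
  by rewrite mp.
pose h k y := phi k y - mean (nu k) (phi k).
have bh k : bmeas (h k) by exact: bmeasB (pphi k) (bmeas_cst _).
pose q k (x : m.-tuple T) := h k (tnth x k).
have bq k : bmeas (q k) := bmeas_tnth k (bh k).
have qK k x : `|q k x| <= 2 * K.
  apply: le_trans (ler_normB _ _) _; rewrite mulr_natl mulr2n lerD//.
  exact: norm_mean_le.
(* The linear term for [k] is constant in any other coordinate, so it is also a
   conditional mean; this is where two marginals are needed. *)
pose i k := xchoose (other k).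
have ik k : i k != k := xchooseP (other k).
have mq mu k y : mean (product_probability mu) (fun x => q k (upd (i k) y x)) =
    mean (mu k) (phi k) - mean (nu k) (phi k).
  transitivity (mean (product_probability mu) (fun x => h k (tnth x k))).
    by apply: eq_mean => x; rewrite /q tnth_upd eq_sym (negbTE (ik k)).
  rewrite (mean_tnth mu k (bh k)).
  by rewrite (meanB _ (pphi k) (bmeas_cst _)) mean_cst.
have qdelta k y :
    `|mean (product_probability nu) (fun x => q k (upd (i k) y x))| <= delta.
  by rewrite mq subrr normr0 ltW.
pose A k := conditional_sqr xi (i k) (q k).
pose G k := conditional_sqr xi k p.
pose W w := 3 * (m%:R * \sum_k A k w + (1 + 2 * K) ^+ 2 * (m%:R * \sum_k G k w) +
                 9 * delta ^+ 2).
have bA k : bmeas (A k) by exact: bmeas_conditional_sqr.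
have bG k : bmeas (G k) by exact: bmeas_conditional_sqr.
have bsum (F : 'I_m -> Omega -> R) : (forall k, bmeas (F k)) ->
    bmeas (fun w => \sum_k F k w) by move=> bF; apply: bmeas_sum => k _.
have bSA := bmeasM (bmeas_cst m%:R) (bsum _ bA).
have bSG := bmeasM (bmeas_cst m%:R) (bsum _ bG).
have bSG' := bmeasM (bmeas_cst ((1 + 2 * K) ^+ 2)) bSG.
have bAG := bmeasD bSA bSG'.
have b9 := bmeas_cst (T := Omega) (9 * delta ^+ 2).
exists W; split.
- exact: bmeasM (bmeas_cst 3) (bmeasD bAG b9).
- move=> w Xw; have := stab _ Xw.
  set Dl := _ - _; set S1 := \sum_k `|_|; set S2 := \sum_k mean _ _ => DS.
  have AE k : A k w = `|mean (hat w k) (phi k) - mean (nu k) (phi k)| ^+ 2.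
    rewrite /A /conditional_sqr real_normK ?num_real//.
    rewrite -[RHS](mean_cst (hat w (i k))).
    by apply: eq_mean => y; rewrite mq.
  have GE k : mean (hat w k) (fun y => `|marg (hat w) b phi k y - 1|) ^+ 2 <= G k w.
    have bM := bmeasB (bmeas_marg (hat w) mb k pphi) (bmeas_cst 1).
    apply: le_trans (sqr_mean_le _ (bmeas_norm bM)) _.
    rewrite le_eqVlt; apply/orP; left; apply/eqP.
    by apply: eq_mean => y; rewrite mp real_normK ?num_real.
  rewrite -[Dl ^+ 2]real_normK ?num_real//.
  apply: (@le_trans _ _ ((eps * (S1 + (1 + 2 * K) * S2 + 3 * delta)) ^+ 2)).
    by rewrite lerXn2r// nnegrE ?(le_trans _ DS).
  rewrite exprMn ler_pM2l ?exprn_gt0//.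
  apply: le_trans (sqr_add3_le _ _ _) _; rewrite /W ler_pM2l//.
  apply: lerD; last by rewrite exprMn; lra.
  apply: lerD.
    apply: le_trans (sqr_sum_le _) _; rewrite ler_wpM2l//.
    by apply: ler_sum => k _; rewrite AE.
  rewrite exprMn ler_wpM2l ?sqr_ge0//.
  apply: le_trans (sqr_sum_le _) _; rewrite ler_wpM2l//.
  by apply: ler_sum => k _; exact: GE.
- rewrite (meanZl _ _ (bmeasD bAG b9)) (meanD _ bAG b9) (meanD _ bSA bSG').
  rewrite (meanZl _ _ bSG) mean_cst.
  rewrite !(meanZl _ m%:R) ?mean_sum//; [|by apply: bmeas_sum => k _..].
  pose RA := 1 * (2 * K) + m%:R * (2 * K) ^+ 2.
  pose RG := 1 * L + m%:R * L ^+ 2.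
  have mA k : mean P (A k) <= RA * delta.
    apply: le_trans (mean_conditional_sqr indep law (bq k) (qK k) (qdelta k)) _.
    by rewrite -/delta [leRHS]mulrDl mul1r [X in X + _]mulrC.
  have mG k : mean P (G k) <= RG * delta.
    apply: le_trans (mean_conditional_sqr indep law bp pL (pdelta k)) _.
    by rewrite -/delta [leRHS]mulrDl mul1r [X in X + _]mulrC.
  have summ (F : 'I_m -> R) C : (forall k, F k <= C) -> \sum_k F k <= m%:R * C.
    move=> FC; rewrite mulr_natl -[Y in _ *+ Y]card_ord -sumr_const.
    by apply: ler_sum => k _.
  rewrite /rate_constant -/L -/RA -/RG -/delta.
  set D := (1 + 2 * K) ^+ 2.
  have -> : 3 * (m%:R * (m%:R * RA) + D * (m%:R * (m%:R * RG)) + 9) * delta =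
      3 * (m%:R * (m%:R * (RA * delta)) + D * (m%:R * (m%:R * (RG * delta))) +
           9 * delta) by ring.
  rewrite ler_pM2l//; apply: lerD; last first.
    by rewrite ler_pM2l// expr2 ler_piMl// ltW.
  apply: lerD; first by rewrite ler_wpM2l//; exact: summ.
  by rewrite ler_wpM2l ?sqr_ge0// ler_wpM2l//; exact: summ.
Qed.

Theorem expected_error_le :
  (\int[P]_w (EMOT X c eps (hat w) - EMOT X c eps nu) ^+ 2 <=
   ((eps ^+ 2 * rate_constant m B) / N.+1%:R)%:E)%E.
Proof.
have [W [bW errW meanW]] := expected_error_majorant.
have [G [mG PG] Gsupp] := sample_in_support.
(* The value [+oo] off [G] dominates the error there, whatever it is. *)
pose g w := if w \in G then (eps ^+ 2 * W w)%:E else +oo%E.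
have bV := bmeasM (bmeas_cst (eps ^+ 2)) bW.
have mV : measurable_fun setT (fun w => (eps ^+ 2 * W w)%:E).
  exact/measurable_EFinP/bmeas_measurable.
apply: (@le_trans _ _ (\int[P]_w g w)%E).
  apply: le_integral_majorant => w; first exact: sqre_ge0.
  rewrite /g; case: ifPn => [/[!inE] Gw|_]; last exact: leey.
  have hX := Gsupp _ Gw.
  have f1 := EMOT_fin_num j1 eps0 mX mb bB hX.
  have f2 := EMOT_fin_num j1 eps0 mX mb bB nuX.
  have := errW w hX.
  by rewrite -(fineK f1) -(fineK f2) -EFinB -EFin_expe lee_fin.
have gV : ae_eq P setT g (fun w => (eps ^+ 2 * W w)%:E).
  exists (~` G); split.
  - exact: measurableC.
  - by have := probability_setC P mG; rewrite PG subee.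
  - by move=> w /= nE Gw; apply: nE => _; rewrite /g mem_set.
rewrite (ae_eq_integral (fun w => (eps ^+ 2 * W w)%:E))//.
  by rewrite meanE// lee_fin meanZl// -mulrA ler_pM2l ?exprn_gt0.
apply: measurable_fun_ifT => //; apply: (measurable_fun_bool true).
rewrite setTI (_ : _ @^-1` _ = G)//.
by apply/seteqP; split=> w /=; [exact: set_mem|exact: mem_set].
Qed.

End expected_error.

Lemma measurable_compact_rV {R : realType} {d : nat} (A : set 'rV[R]_d) :
  compact A -> measurable (A : set (borel_rV R d)).
Proof.
move=> /(compact_closed (@norm_hausdorff _ 'rV[R]_d)) Acl.
rewrite -[A]setCK; apply: measurableC; apply: sub_sigma_algebra.
exact: closed_openC.
Qed.

Theorem theorem4p1 (R : realType) :
  exists C : nat -> R -> R -> R,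
  forall (m d : nat) (eps : R) (X : 'I_m -> set 'rV[R]_d)
    (nu : 'I_m -> probability (borel_rV R d) R)
    (c : m.-tuple (borel_rV R d) -> R),
  (2 <= m)%N -> (1 <= d)%N -> 0 < eps ->
  (forall j, compact (X j)) ->
  (forall j, (X j)° !=set0) ->
  (forall j (x : 'rV[R]_d), X j x -> forall i, -1 <= x ord0 i <= 1) ->
  (forall j, nu j (X j) = 1%E) ->
  measurable_fun (prod_set X : set (m.-tuple (borel_rV R d))) c ->
  has_ubound [set `|c x| | x in prod_set X] ->
  let K := C m eps (sup_norm (prod_set X) c) in
  0 < K /\
  forall (N : nat) (disp : measure_display) (Omega : measurableType disp)
    (P : probability Omega R)
    (xi : 'I_m * 'I_N.+1 -> {RV P >-> borel_rV R d}),
  mutually_independent xi ->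
  (forall j k (A : set (borel_rV R d)), measurable A ->
     distribution P (xi (j, k)) A = nu j A) ->
  (\int[P]_w
      (EMOT (T := borel_rV R d) X c eps
         (fun j => empirical (fun k => xi (j, k) w))
       - EMOT (T := borel_rV R d) X c eps nu) ^+ 2
   <= (K / N.+1%:R)%:E)%E.
Proof.
exists (fun m eps M => eps ^+ 2 * rate_constant m (M / eps)).
move=> m d eps X nu c m2 _ eps0 cX X0 _ nuX mc cub.
set M := sup_norm _ c.
have mX j : measurable (X j : set (borel_rV R d)).
  exact: measurable_compact_rV.
have cM x : prod_set X x -> `|c x| <= M.
  move=> Xx; apply: ub_le_sup; [exact: cub|by exists x].
have M0 : 0 <= M.
  have X0' j : exists x, X j x.
    by have [x /nbhs_singleton Xx] := X0 j; exists x.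
  pose x : m.-tuple (borel_rV R d) := [tuple projT1 (cid (X0' j)) | j < m].
  apply: le_trans (normr_ge0 (c x)) (cM x _) => j.
  by rewrite tnth_mktuple; exact: (projT2 (cid (X0' j))).
have B0 : 0 <= M / eps by rewrite divr_ge0// ltW.
have bB (x : m.-tuple (borel_rV R d)) : `|scaled_cost (T := borel_rV R d) X c eps x| <= M / eps.
  rewrite /scaled_cost normrM normfV (gtr0_norm eps0) ler_pM2r ?invr_gt0//.
  rewrite patchE; case: ifPn => [/set_mem/cM//|_].
  by rewrite normr0.
have mb : bmeas (scaled_cost (T := borel_rV R d) X c eps).
  apply: bmeas_le bB; apply: measurable_funM; last exact: measurable_cst.
  have mprod := measurable_prod_set (T := borel_rV R d) mX.
  exact: (measurable_restrictT c mprod).1 mc.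
split; last first.
  move=> N disp Omega P xi indep law.
  exact: expected_error_le.
rewrite mulr_gt0 ?exprn_gt0// /rate_constant mulr_gt0//.
have KB0 : 0 <= potential_bound m (M / eps).
  exact: potential_bound_ge0 bB.
rewrite ltr_wpDl// addr_ge0// ?mulr_ge0 ?addr_ge0 ?mulr_ge0 ?sqr_ge0 ?expR_ge0//.
Qed.
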